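(* Let $G$ be a bridgeless cubic graph. Then $G$ has a proper 5-edge-coloring $\phi\colon E(G)\to\{1,2,3,4,5\}$ in which at least $|E(G)|-\mu_3(G)$ edges are normal.
   Context: Let $\phi$ be a proper 5-edge-coloring of a cubic graph $G$. An edge $e$ is poor (resp. rich) if $e$ together with its four adjacent edges uses exactly 3 (resp. 5) colors in total; $e$ is normal if it is poor or rich. For a list $S_3$ of three 1-factors $M_1,M_2,M_3$ of $G$ and $0\le i\le 3$, let $E_i$ be the set of edges of $G$ contained in exactly $i$ of $M_1,M_2,M_3$. If $|E_0|=k$, the subgraph $G[E_0\cup E_2\cup E_3]$ is called the $k$-core of $G$ with respect to $M_1,M_2,M_3$. The parameter $\mu_3(G)$ is the minimum $k$ such that $G$ has a $k$-core (i.e. the minimum, over all choices of three 1-factors $M_1,M_2,M_3$ of $G$, of the number of edges in none of them). *)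

(* Defs.v *)
From mathcomp Require Import all_boot.
Set Implicit Arguments.
Unset Strict Implicit.
Unset Printing Implicit Defensive.

(* Finite graphs, parallel edges allowed.  Loops are excluded by [card_ends];
   this loses nothing for bridgeless cubic graphs, since the third edge at a
   vertex carrying a loop would be a bridge. *)
Record multigraph := MultiGraph {
  vertex : finType;
  edge : finType;
  ends : edge -> {set vertex};
  card_ends : forall e, #|ends e| = 2 }.

Section Multigraph.
Variable G : multigraph.
Implicit Types (e f : edge G) (x y v : vertex G) (M C : {set edge G}).

Definition incident v : {set edge G} := [set e | v \in ends e].

Definition cubic : bool := [forall v, #|incident v| == 3].

Definition adj_without e : rel (vertex G) :=
  fun x y => [exists f, (f != e) && (ends f == [set x; y])].

Definition bridge e : bool :=
  [exists x in ends e, exists y in ends e, ~~ connect (adj_without e) x y].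

Definition bridgeless : bool := [forall e, ~~ bridge e].

Definition one_factor M : bool := [forall v, #|M :&: incident v| == 1].

Definition covered (S : 3.-tuple {set edge G}) (i : nat) : {set edge G} :=
  [set e | count (fun M => e \in M) S == i].

(* The subgraph G[E_0 u E_2 u E_3] is represented by its edge set. *)
Definition is_core (k : nat) C : bool :=
  [exists S : 3.-tuple {set edge G},
    [&& all one_factor S, #|covered S 0| == k
      & C == covered S 0 :|: covered S 2 :|: covered S 3]].

Definition has_core (k : nat) : bool := [exists C, is_core k C].

(* The default value #|edge G| is never below a genuine k, so it only shows up
   when G has no 1-factor at all; see [mu3_le] and [has_core_mu3]. *)
Definition mu3 : nat :=
  \big[minn/#|edge G|]_(k < #|edge G|.+1 | has_core k) k.

Definition adjacent e f : bool :=
  (e != f) && (ends e :&: ends f != set0).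

Section Coloring.
Variables (K : finType) (phi : edge G -> K).

Definition proper_coloring : Prop := forall e f, adjacent e f -> phi e != phi f.

Definition palette e : {set K} :=
  [set phi f | f in [pred f | (f == e) || adjacent e f]].

Definition poor e : bool := #|palette e| == 3.
Definition rich e : bool := #|palette e| == 5.
Definition normal e : bool := poor e || rich e.

End Coloring.

Lemma has_core_ub k : has_core k -> k <= #|edge G|.
Proof. by case/existsP=> C /existsP[S /and3P[_ /eqP<- _]]; apply: max_card. Qed.

Lemma mu3_le k : has_core k -> mu3 <= k.
Proof.
move=> hk; have ltk : k < #|edge G|.+1 by rewrite ltnS has_core_ub.
rewrite /mu3 unlock; have: Ordinal ltk \in index_enum 'I_(#|edge G|.+1).
  exact: mem_index_enum.
elim: index_enum => //= i s IHs; rewrite inE => /predU1P[<-|/IHs le_s].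
  by rewrite hk geq_minl.
by case: ifP => // _; apply: leq_trans (geq_minr _ _) le_s.
Qed.

Lemma has_core_mu3 : (exists M, one_factor M) -> has_core mu3.
Proof.
case=> M0 M0P; pose S := [tuple M0; M0; M0].
have hS : has_core #|covered S 0|.
  apply/existsP; exists (covered S 0 :|: covered S 2 :|: covered S 3).
  by apply/existsP; exists S; rewrite /= M0P !eqxx.
suff: has_core mu3 \/ mu3 = #|edge G|.
  case=> // eqm; have := mu3_le hS; rewrite eqm => le_m.
  by have/eqP->: #|edge G| == #|covered S 0| by rewrite eqn_leq le_m max_card.
rewrite /mu3; apply: (big_ind (fun m => has_core m \/ m = #|edge G|)).
- by right.
- by move=> m n Pm Pn; rewrite /minn; case: ifP.
- by move=> i Pi; left.
Qed.

End Multigraph.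

(* Main.v *)
Require Import Defs.
From mathcomp Require Import all_boot.
Set Implicit Arguments.
Unset Strict Implicit.
Unset Printing Implicit Defensive.

(* Fix three 1-factors with |E_0| = mu_3 and colour the edges of E_1 by the
   index k < 3 of the 1-factor containing them.  The circuits formed by E_0 and
   E_2 are read as cyclic words: a letter K is an edge of E_2, labelled by the
   1-factor k missing it (so its two ends send out edges of colour k), a letter
   V is an end of an edge of E_3, and the gaps between letters are the edges of
   E_0.  It suffices that, outside E_0, there are at most as many bad edges as
   there are normal edges in E_0.  Every edge of E_3 gets a leg colour in {3, 4}
   and a type in {0, 1, 2} describing the colours wanted at its two ends; given
   these data, each circuit can be coloured on its own.

   In a word without V, gaps and letters alternate between 3 and 4.  Any other
   word is cut into short tokens such as VV, VKV or VKK
   between which the gap colour is 3 or 4.  A token asks for at most one type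
   different from some k per letter V, and joins each letter V with at most one
   other one whose leg colour must agree; an edge of E_3 has two ends, so types
   exist, and leg colours exist by a not-all-equal satisfiability argument, which
   also covers the circuits VVV, where the three legs must not be all equal. *)

(** * Not-all-equal constraints with at most two occurrences per variable *)

(** The types come from perfect matchings. The four colours other than that of an edge split into
    two pairs in three ways, and the edge is normal as soon as both of its ends use pairs of the
    same splitting: equal pairs make it poor, complementary pairs make it rich. For an edge of E_1
    the splitting is fixed, {3, 4} against the rest; for an edge of E_3 it is free and is its type.
    Circuits interact only through edges of E_3, whose two ends may lie on different circuits; this
    is why leg colours and types are settled before any circuit is coloured. Gaps of one constant
    colour in {3, 4} cost nothing at letters K, but at a V the leg takes one of 3 and 4, so one of
    the two gaps must be below 3. Passing between {3, 4} and {0, 1, 2} is free at a V whose type is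
    the low gap colour, whereas at a K it costs two bad edges, one in E_2 and one in E_1. Tokens are
    short excursions below 3 whose normal gaps pay for such passages and for unmatched letters V;
    VKV has one normal gap to spare, and VK lacks one. *)

Section NotAllEqual.
Variable X : eqType.
Implicit Types (a : X -> bool) (l : X * bool) (t : seq (X * bool)) (ts : seq (seq (X * bool))).

Definition lit a l := a l.1 (+) l.2.
Definition nae a t := has (lit a) t && has (predC (lit a)) t.
Definition occ (x : X) ts := count_mem x (map fst (flatten ts)).

Definition subst_lit (y : X) l l' := if l'.1 == y then (l.1, l.2 (+) l'.2) else l'.

Lemma lit_subst a y l l' :
  lit a (subst_lit y l l') = lit (fun z => if z == y then lit a l else a z) l'.
Proof. by rewrite /lit /subst_lit; case: eqP => //= _; rewrite addbA. Qed.

Lemma nae_subst a y l t :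
  nae a (map (subst_lit y l) t) = nae (fun z => if z == y then lit a l else a z) t.
Proof.
by rewrite /nae !has_map; congr (_ && _); apply: eq_has => l' /=; rewrite lit_subst.
Qed.

Lemma occ_cons x t ts : occ x (t :: ts) = count_mem x (map fst t) + occ x ts.
Proof. by rewrite /occ /= map_cat count_cat. Qed.

Lemma occ_subst x y l ts : l.1 != y ->
  occ x (map (map (subst_lit y l)) ts) =
  if x == y then 0 else occ x ts + (if x == l.1 then occ y ts else 0).
Proof.
move=> ly; rewrite /occ -map_flatten.
elim: (flatten ts) => [|m s IHs] /=; first by case: (x == y); case: (x == l.1).
rewrite {}IHs /subst_lit; case: (eqVneq x y) => [->|xy].
  by case: (eqVneq m.1 y) => [_|my] /=; rewrite addn0 ?(negPf ly) ?(negPf my).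
case: (eqVneq m.1 y) => [->|my] /=.
  rewrite (eq_sym y) (negPf xy) add0n eq_sym.
  by case: (x == l.1); rewrite ?addn0 //= addnCA.
by case: (x == l.1); rewrite ?addn0 ?addnA.
Qed.

(** Each of the two merged variables spends one occurrence in [t], so their remaining occurrences
    add up to at most 1 + 1. *)
Lemma occ_subst_le y l t ts : l.1 != y ->
  l.1 \in map fst t -> y \in map fst t ->
  (forall x, occ x (t :: ts) <= 2) ->
  forall x, occ x (map (map (subst_lit y l)) ts) <= 2.
Proof.
move=> ly lt yt occ2 x; rewrite occ_subst //; case: (x == y) => //.
have := occ2 x; rewrite occ_cons => /(leq_trans (leq_addl _ _)).
case: eqP => [->|_]; last by rewrite addn0.
have: 0 < count_mem l.1 (map fst t) by rewrite -has_count has_pred1.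
have: 0 < count_mem y (map fst t) by rewrite -has_count has_pred1.
have := occ2 y; have := occ2 l.1; rewrite !occ_cons.
move: (count_mem _ _) (count_mem _ _) (occ _ _) (occ _ _) => c1 c2 o1 o2 h1 h2 h3 h4 _.
rewrite -[2]/(1 + 1) leq_add // -ltnS.
  by apply: leq_trans h1; rewrite -addn1 addnC leq_add2r.
by apply: leq_trans h2; rewrite -addn1 addnC leq_add2r.
Qed.


(* Making the literal [m] opposite to [l] satisfies the clause and merges two
   variables, without raising any number of occurrences above two. *)
Lemma nae_step t ts (l m : X * bool) : l \in t -> m \in t -> l.1 != m.1 ->
  (exists a, all (nae a) (map (map (subst_lit m.1 (l.1, l.2 (+) ~~ m.2))) ts)) ->
  exists a, all (nae a) (t :: ts).
Proof.
move=> lt mt lm [a]; rewrite all_map => /allP aP.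
exists (fun z => if z == m.1 then lit a (l.1, l.2 (+) ~~ m.2) else a z) => /=.
apply/andP; split; last by apply/allP => u /aP /=; rewrite nae_subst.
have litl : lit (fun z => if z == m.1 then lit a (l.1, l.2 (+) ~~ m.2) else a z) l
    = lit a l by rewrite /lit (negPf lm).
have litm : lit (fun z => if z == m.1 then lit a (l.1, l.2 (+) ~~ m.2) else a z) m
    = ~~ lit a l.
  by rewrite /lit /= eqxx; case: (a _) (l.2) (m.2) => [] [] [].
case: (boolP (lit a l)) => al; apply/andP; split; apply/hasP.
- by exists l; rewrite ?litl.
- by exists m; rewrite //= litm al.
- by exists m; rewrite ?litm.
- by exists l; rewrite //= litl.
Qed.

(** Three literals cannot all involve one variable that occurs at most twice, so [nae_step] applies
    to every clause. *)
Lemma nae_solve_triples ts :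
  (forall t, t \in ts -> size t = 3) -> (forall x, occ x ts <= 2) ->
  exists a, all (nae a) ts.
Proof.
have [n] := ubnP (size ts); elim: n ts => // n IHn [|t ts] szts sz3 occ2.
  by exists (fun=> true).
have [l [m [lt mt lm]]] : exists l m, [/\ l \in t, m \in t & l.1 != m.1].
  have := sz3 t (mem_head _ _); have := occ2.
  case: t {sz3 occ2 szts} => [|l1 [|l2 [|l3 []]]] // occ2 _.
  case: (eqVneq l1.1 l2.1) => [e12|]; last first.
    by exists l1, l2; rewrite !inE !eqxx ?orbT.
  case: (eqVneq l1.1 l3.1) => [e13|]; last first.
    by exists l1, l3; rewrite !inE !eqxx ?orbT.
  by have := occ2 l1.1; rewrite occ_cons /= -e12 -e13 eqxx.
apply: (nae_step lt mt lm); apply: IHn.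
- by rewrite size_map.
- by move=> u /mapP[v vts ->]; rewrite size_map sz3 // inE vts orbT.
- by apply: (@occ_subst_le _ _ t) => //=; apply: map_f.
Qed.

Definition eq_clause (p : X * X) := [:: (p.1, false); (p.2, true)].

Lemma nae_eq_clause a p : nae a (eq_clause p) = (a p.1 == a p.2).
Proof. by rewrite /nae /lit /=; case: (a _) (a _) => [] []. Qed.

(** Equalities are eliminated before the triples: replacing [y] by [x] with the same sign turns
    equalities into equalities, whereas merging opposite literals of a triple could turn one into an
    unsatisfiable clause. *)
Lemma nae_solve (es : seq (X * X)) ts :
  (forall t, t \in ts -> size t = 3) ->
  (forall x, occ x (map eq_clause es ++ ts) <= 2) ->
  exists a, all (nae a) (map eq_clause es ++ ts).
Proof.
elim: {es}(size es) {-2}es (erefl (size es)) ts => [|n IHn] [|[x y] es] //= szes ts sz3.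
  exact: nae_solve_triples.
case: szes => szes occ2; case: (eqVneq x y) => [<-|xy].
  have [|a aP] := IHn es szes ts sz3.
    by move=> z; apply: leq_trans (occ2 z); rewrite occ_cons leq_addl.
  by exists a; rewrite nae_eq_clause eqxx.
apply: (@nae_step _ _ (x, false) (y, true)); rewrite ?inE ?eqxx ?orbT //=.
have := @occ_subst_le y (x, false) (eq_clause (x, y)) _ xy (mem_head _ _) _ occ2.
rewrite /= !inE eqxx orbT => /(_ isT).
set sb := subst_lit _ _.
have -> : map (map sb) (map eq_clause es ++ ts) =
    map eq_clause [seq (if p.1 == y then x else p.1, if p.2 == y then x else p.2) | p <- es]
    ++ map (map sb) ts.
  rewrite map_cat -!map_comp; congr (_ ++ _); apply: eq_map => p /=.
  by rewrite /sb /subst_lit /eq_clause /=; do 2!case: ifP.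
move=> occ2'; apply: IHn => //; first by rewrite size_map.
by move=> u /mapP[v vts ->]; rewrite size_map sz3.
Qed.

End NotAllEqual.

Definition legcol (lam : bool) : nat := 3 + lam.

(** * Colouring words *)

(* [inl k] is a letter K missing from the 1-factor k; [inr (lam, x)] is a letter
   V with leg colour [legcol lam] and type [x].  The colour of a letter is a pair
   [(g, e)]: [g] colours the gap after the letter, and [e] the edge of E_2 (it is
   meaningless for V).  The colour of the gap before a letter is called [gin]. *)
Notation datum := (nat + bool * nat)%type.
Notation colour := (nat * nat)%type.

Section WordColours.
Implicit Types (d : datum) (c : colour) (s : seq (datum * colour)) (ds : seq datum).

Definition fits gin d c : bool :=
  match d with
  | inl k => [&& c.1 < 5, c.2 < 5, gin != c.2, c.1 != c.2, k != c.2, gin != k & c.1 != k]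
  | inr (lam, _) => [&& c.1 < 5, gin != c.1, gin != legcol lam & c.1 != legcol lam]
  end.

Definition normal_cols (cs : seq nat) : bool := size (undup cs) \in [:: 3; 5].

(* In a proper colouring, the two colours other than k at an end of an E_1 edge
   coloured k are {3, 4} or the complement of k in {0, 1, 2}, precisely when they
   lie on the same side; if this holds at both ends, the edge is normal. *)
Definition same_side (a b : nat) : bool := (2 < a) == (2 < b).

(* When [a], [b] and the leg colour are distinct: {a, b} consists of x and one of
   3, 4, or is the complement of x in {0, 1, 2}.  A leg is normal when both of
   its ends are matched with the same x. *)
Definition matched (x a b : nat) : bool :=
  ((x == a) || (x == b)) == ((2 < a) || (2 < b)).

Definition letter_cost gin d c : nat :=
  match d with
  | inl k => ~~ normal_cols [:: c.2; gin; k; c.1; k]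
             + ~~ same_side gin c.2 + ~~ same_side c.1 c.2
  | inr (_, x) => ~~ matched x gin c.1
  end.

(** These are the two further colours met by a gap at either of its ends: [right_pair] for the gap
    following a letter, [left_pair] for the gap preceding it. At a K they belong to the edges of E_2
    and E_1, at a V to the leg and to the gap on the other side. *)
Definition right_pair gin (a : datum * colour) : nat * nat :=
  match a.1 with inl k => (a.2.2, k) | inr (lam, _) => (legcol lam, gin) end.

Definition left_pair (a : datum * colour) : nat * nat :=
  match a.1 with inl k => (a.2.2, k) | inr (lam, _) => (legcol lam, a.2.1) end.

Definition gap_normal gin (a b : datum * colour) : bool :=
  normal_cols [:: a.2.1; (right_pair gin a).1; (right_pair gin a).2;
                  (left_pair b).1; (left_pair b).2].

Fixpoint valid gin s : bool :=
  if s is a :: s' then fits gin a.1 a.2 && valid a.2.1 s' else true.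

Fixpoint cost gin s : nat :=
  if s is a :: s' then letter_cost gin a.1 a.2 + cost a.2.1 s' else 0.

(** The last gap is left out because its normality depends on the letter that follows the word; this
    makes [gain_cat] an inequality. *)
Fixpoint gain gin s : nat :=
  if s is a :: s' then
    (if s' is b :: _ then gap_normal gin a b : nat else 0) + gain a.2.1 s'
  else 0.

Definition out gin s : nat := last gin [seq a.2.1 | a <- s].

Lemma valid_cat gin s1 s2 :
  valid gin (s1 ++ s2) = valid gin s1 && valid (out gin s1) s2.
Proof. by elim: s1 gin => //= a s1 IHs gin; rewrite IHs andbA. Qed.

Lemma cost_cat gin s1 s2 :
  cost gin (s1 ++ s2) = cost gin s1 + cost (out gin s1) s2.
Proof. by elim: s1 gin => //= a s1 IHs gin; rewrite IHs addnA. Qed.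

Lemma gain_cat gin s1 s2 :
  gain gin s1 + gain (out gin s1) s2 <= gain gin (s1 ++ s2).
Proof.
elim: s1 gin => //= a s1 IHs gin; rewrite -addnA leq_add //.
by case: s1 {IHs}.
Qed.

Lemma out_cat gin s1 s2 : out gin (s1 ++ s2) = out (out gin s1) s2.
Proof. by rewrite /out map_cat last_cat. Qed.

(* Makes an edge of E_2 normal if [gin = g], and otherwise keeps it proper while
   only one of its two ends leaves the [same_side] condition. *)
Definition edge_colour (k gin g : nat) : nat :=
  if (2 < gin) && (2 < g) then 7 - gin else 3 - k - minn gin g.

Fixpoint paint gin ds (gs : seq nat) : seq (datum * colour) :=
  match ds, gs with
  | d :: ds', g :: gs' =>
      (d, (g, if d is inl k then edge_colour k gin g else 0)) :: paint g ds' gs'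
  | _, _ => [::]
  end.

Lemma paint_fst gin ds gs : size gs = size ds -> map fst (paint gin ds gs) = ds.
Proof. by elim: ds gin gs => [|d ds IHd] gin [|g gs] //= [sz]; rewrite IHd. Qed.

(* [credit] and [debit] shift the balance between normal gaps and costs. *)
Definition solves gin gout credit debit ds gs : bool :=
  let s := paint gin ds gs in
  [&& size gs == size ds, valid gin s, out gin s == gout
    & cost gin s + credit <= gain gin s + debit].

Definition solvable gin gout credit debit ds : Prop :=
  exists s, [/\ map fst s = ds, valid gin s, out gin s = gout
              & cost gin s + credit <= gain gin s + debit].

Lemma solvesP gin gout credit debit ds gs :
  solves gin gout credit debit ds gs -> solvable gin gout credit debit ds.
Proof.
case/and4P=> /eqP sz val_s /eqP out_s le_s.
by exists (paint gin ds gs); rewrite paint_fst.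
Qed.

Definition bools := [:: true; false].
Definition kinds := iota 0 3.

Lemma in_bools b : b \in bools. Proof. by case: b. Qed.
Lemma in_kinds k : k < 3 -> k \in kinds. Proof. by rewrite mem_iota. Qed.

Lemma solve_K k b : k < 3 -> solvable (legcol b) (legcol b) 0 0 [:: inl k].
Proof.
move/in_kinds=> hk; apply: (@solvesP _ _ _ _ _ [:: legcol b]).
have: all (fun k => all (fun b =>
  solves (legcol b) (legcol b) 0 0 [:: inl k] [:: legcol b]) bools) kinds by [].
by move=> /allP/(_ k hk)/allP/(_ b (in_bools b)).
Qed.

(** The inner gap meets 3 and 4 at both ends, hence is poor; it pays for the second V, whose type
    may differ from [x]. *)
Lemma solve_VV l m x y : x < 3 -> y < 3 ->
  solvable (legcol (~~ l)) (legcol (~~ m)) 0 0 [:: inr (l, x); inr (m, y)].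
Proof.
move=> /in_kinds hx /in_kinds hy; apply: (@solvesP _ _ _ _ _ [:: x; legcol (~~ m)]).
have: all (fun l => all (fun m => all (fun x => all (fun y =>
  solves (legcol (~~ l)) (legcol (~~ m)) 0 0 [:: inr (l, x); inr (m, y)]
    [:: x; legcol (~~ m)]) kinds) kinds) bools) bools by vm_compute.
by move=> /allP/(_ l (in_bools l))/allP/(_ m (in_bools m))/allP/(_ x hx)/allP/(_ y hy).
Qed.

(** As [x != k], the colour [x] can be kept across the K at no cost, and both inner gaps are rich.
    Only the second V may be unmatched, which leaves one normal gap to spare. *)
Lemma solve_VKV l m x y k : x < 3 -> y < 3 -> k < 3 -> x != k ->
  solvable (legcol (~~ l)) (legcol (~~ m)) 1 0 [:: inr (l, x); inl k; inr (m, y)].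
Proof.
move=> /in_kinds hx /in_kinds hy /in_kinds hk xk.
apply: (@solvesP _ _ _ _ _ [:: x; x; legcol (~~ m)]).
have: all (fun l => all (fun m => all (fun x => all (fun y => all (fun k =>
  (x != k) ==>
  solves (legcol (~~ l)) (legcol (~~ m)) 1 0 [:: inr (l, x); inl k; inr (m, y)]
    [:: x; x; legcol (~~ m)]) kinds) kinds) kinds) bools) bools by vm_compute.
move=> /allP/(_ l (in_bools l))/allP/(_ m (in_bools m))/allP/(_ x hx)/allP/(_ y hy).
by move=> /allP/(_ k hk)/implyP/(_ xk).
Qed.

(** The passage back to {3, 4} costs two and takes place at the second K unless [x == k'] forbids
    it. The gap after V is rich, and the gap between the letters K is poor if the passage is at the
    second K, rich if it is at the first. *)
Lemma solve_VKK l b x k k' : x < 3 -> k < 3 -> k' < 3 -> x != k ->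
  solvable (legcol (~~ l)) (legcol b) 0 0 [:: inr (l, x); inl k; inl k'].
Proof.
move=> /in_kinds hx /in_kinds hk /in_kinds hk' xk.
apply: (@solvesP _ _ _ _ _ [:: x; if x == k' then legcol b else x; legcol b]).
have: all (fun l => all (fun b => all (fun x => all (fun k => all (fun k' =>
  (x != k) ==>
  solves (legcol (~~ l)) (legcol b) 0 0 [:: inr (l, x); inl k; inl k']
    [:: x; if x == k' then legcol b else x; legcol b])
  kinds) kinds) kinds) bools) bools by vm_compute.
move=> /allP/(_ l (in_bools l))/allP/(_ b (in_bools b))/allP/(_ x hx)/allP/(_ k hk).
by move=> /allP/(_ k' hk')/implyP/(_ xk).
Qed.

Lemma solve_VK l b x k : x < 3 -> k < 3 -> x != k ->
  solvable (legcol (~~ l)) (legcol b) 0 1 [:: inr (l, x); inl k].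
Proof.
move=> /in_kinds hx /in_kinds hk xk.
apply: (@solvesP _ _ _ _ _ [:: x; legcol b]).
have: all (fun l => all (fun b => all (fun x => all (fun k => (x != k) ==>
  solves (legcol (~~ l)) (legcol b) 0 1 [:: inr (l, x); inl k] [:: x; legcol b])
  kinds) kinds) bools) bools by vm_compute.
move=> /allP/(_ l (in_bools l))/allP/(_ b (in_bools b))/allP/(_ x hx).
by move=> /allP/(_ k hk)/implyP/(_ xk).
Qed.

Lemma solve_VVKV l1 l2 l3 x1 x2 x3 k :
  x1 < 3 -> x2 < 3 -> x3 < 3 -> k < 3 -> x3 != k ->
  solvable (legcol (~~ l1)) (legcol (~~ l3)) 0 0
    [:: inr (l1, x1); inr (l2, x2); inl k; inr (l3, x3)].
Proof.
move=> /in_kinds h1 /in_kinds h2 /in_kinds h3 /in_kinds hk xk.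
(* The gaps [x1] and [x3] match the first and last V. If they are equal, rising to {3, 4} in between
   makes all three inner gaps normal, which pays two for the K and one for the middle V; otherwise
   only the middle V can cost, and the rich gap before the last V pays for it. *)
pose gs l2 l3 x1 x3 :=
  [:: x1; if x1 == x3 then legcol (~~ l2) else x3; x3; legcol (~~ l3)].
apply: (@solvesP _ _ _ _ _ (gs l2 l3 x1 x3)).
have: all (fun l1 => all (fun l2 => all (fun l3 =>
  all (fun x1 => all (fun x2 => all (fun x3 => all (fun k => (x3 != k) ==>
  solves (legcol (~~ l1)) (legcol (~~ l3)) 0 0
    [:: inr (l1, x1); inr (l2, x2); inl k; inr (l3, x3)] (gs l2 l3 x1 x3))
  kinds) kinds) kinds) kinds) bools) bools) bools by vm_compute.
move=> /allP/(_ l1 (in_bools l1))/allP/(_ l2 (in_bools l2))/allP/(_ l3 (in_bools l3)).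
by move=> /allP/(_ x1 h1)/allP/(_ x2 h2)/allP/(_ x3 h3)/allP/(_ k hk)/implyP/(_ xk).
Qed.


Definition triples := [seq (p, z) | p <- [seq (x, y) | x <- kinds, y <- kinds], z <- kinds].

(* Five consecutive vertices coloured [a 3 b c] or [a 4 b c] on their four inner
   gaps have types a, a, b, the third one, c. *)
Definition quint_fit (x0 x1 x2 x3 x4 : nat) : seq (nat * nat * nat) :=
  [seq p <- triples | (p.1.2 != p.2) &&
     (4 <= (x0 == p.1.1) + (x1 == p.1.1) + (x2 == p.1.2) + (x3 == 3 - p.1.2 - p.2)
           + (x4 == p.2) + (p.1.1 == p.1.2))].

Definition quint_link (T : Type) (x0 x1 x2 x3 x4 : nat) (v1 v2 v3 : T) : T * T :=
  if quint_fit x0 x1 x2 x3 x4 is [::] then (v2, v3) else (v1, v2).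

Definition quint_gaps (l1 l2 l3 l4 : bool) (x0 x1 x2 x3 x4 : nat) : seq nat :=
  if quint_fit x0 x1 x2 x3 x4 is (a, b, c) :: _ then
    [:: a; legcol (~~ l2); b; c; legcol (~~ l4)]
  else if quint_fit x4 x3 x2 x1 x0 is (a, b, c) :: _ then
    [:: c; b; legcol (~~ l2); a; legcol (~~ l4)]
  else [::].

(** In the direction of reading, the gap a is poor, and the gap coloured 3 or 4 is poor when a = b.
    The cost being the number of unmatched letters, 5 minus the matches must be at most 1 + (a ==
    b): hence the bound 4 in [quint_fit]. The legs at the two ends of the gap coloured 3 or 4 must
    agree, which is the link. For all types, the pattern fits in at least one of the two
    directions. *)
Lemma solve_VVVVV l0 l1 l2 l3 l4 x0 x1 x2 x3 x4 :
  x0 < 3 -> x1 < 3 -> x2 < 3 -> x3 < 3 -> x4 < 3 ->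
  (let p := quint_link x0 x1 x2 x3 x4 l1 l2 l3 in p.1 = p.2) ->
  solvable (legcol (~~ l0)) (legcol (~~ l4)) 0 0
    [:: inr (l0, x0); inr (l1, x1); inr (l2, x2); inr (l3, x3); inr (l4, x4)].
Proof.
move=> /in_kinds h0 /in_kinds h1 /in_kinds h2 /in_kinds h3 /in_kinds h4 /= /eqP lk.
apply: (@solvesP _ _ _ _ _ (quint_gaps l1 l2 l3 l4 x0 x1 x2 x3 x4)); move: lk.
have: all (fun x0 => all (fun x1 => all (fun x2 => all (fun x3 => all (fun x4 =>
  all (fun l0 => all (fun l1 => all (fun l2 => all (fun l3 => all (fun l4 =>
  (let p := quint_link x0 x1 x2 x3 x4 l1 l2 l3 in p.1 == p.2) ==>
  solves (legcol (~~ l0)) (legcol (~~ l4)) 0 0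
    [:: inr (l0, x0); inr (l1, x1); inr (l2, x2); inr (l3, x3); inr (l4, x4)]
    (quint_gaps l1 l2 l3 l4 x0 x1 x2 x3 x4))
  bools) bools) bools) bools) bools) kinds) kinds) kinds) kinds) kinds by vm_compute.
move=> /allP/(_ x0 h0)/allP/(_ x1 h1)/allP/(_ x2 h2)/allP/(_ x3 h3)/allP/(_ x4 h4).
move=> /allP/(_ l0 (in_bools l0))/allP/(_ l1 (in_bools l1))/allP/(_ l2 (in_bools l2)).
by move=> /allP/(_ l3 (in_bools l3))/allP/(_ l4 (in_bools l4))/implyP.
Qed.

Fixpoint gain_on gin s (b : datum * colour) : nat :=
  if s is a :: s' then
    gap_normal gin a (head b s') + gain_on a.2.1 s' b
  else 0.

Lemma gain_le_on gin s b : gain gin s <= gain_on gin s b.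
Proof.
elim: s gin => //= a s IHs gin; by case: s IHs => [|c s] IHs; rewrite leq_add ?IHs.
Qed.

(* Colourings of a whole circuit, where the last gap leads back to the head. *)
Definition closed_solvable ds : Prop :=
  exists gin s b, [/\ map fst (b :: s) = ds, valid gin (b :: s), out gin (b :: s) = gin
              & cost gin (b :: s) <= gain_on gin (b :: s) b].

Lemma closed_of_solvable gin d ds : solvable gin gin 0 0 (d :: ds) ->
  closed_solvable (d :: ds).
Proof.
case=> -[|b s] [// eq_ds val_s out_s]; rewrite !addn0 => le_s.
by exists gin, s, b; split=> //; apply: leq_trans le_s (gain_le_on _ _ _).
Qed.

Definition closed_solves gin ds gs : bool :=
  if paint gin ds gs is b :: s then
    [&& size gs == size ds, valid gin (b :: s), out gin (b :: s) == gin
      & cost gin (b :: s) <= gain_on gin (b :: s) b]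
  else false.

Lemma closed_solvesP gin ds gs : closed_solves gin ds gs -> closed_solvable ds.
Proof.
rewrite /closed_solves; case def_s: (paint _ _ _) => [//|b s].
case/and4P=> /eqP sz val_s /eqP out_s le_s.
by exists gin, s, b; rewrite -def_s paint_fst // def_s.
Qed.

(** On a circuit, the gap leading from K back to V is rich too, and covers the debit of
    [solve_VK]. *)
Lemma closed_solve_VK l x k : x < 3 -> k < 3 -> x != k ->
  closed_solvable [:: inr (l, x); inl k].
Proof.
move=> /in_kinds hx /in_kinds hk xk.
apply: (@closed_solvesP (legcol (~~ l)) _ [:: x; legcol (~~ l)]).
have: all (fun l => all (fun x => all (fun k => (x != k) ==>
  closed_solves (legcol (~~ l)) [:: inr (l, x); inl k] [:: x; legcol (~~ l)])
  kinds) kinds) bools by vm_compute.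
by move=> /allP/(_ l (in_bools l))/allP/(_ x hx)/allP/(_ k hk)/implyP/(_ xk).
Qed.

(* All three gaps use colours below three: with legs not all equal, two gaps
   become rich, and the types, being distinct, can be chosen to match a leg. *)
Lemma closed_solve_VVV l1 l2 l3 x1 x2 x3 : x1 < 3 -> x2 < 3 -> x3 < 3 ->
  ~~ ((l1 == l2) && (l2 == l3)) ->
  closed_solvable [:: inr (l1, x1); inr (l2, x2); inr (l3, x3)].
Proof.
move=> /in_kinds h1 /in_kinds h2 /in_kinds h3 nae_l.
pose gs x1 : nat * nat := if x1 is 0 then (1, 2) else if x1 is 1 then (0, 2) else (0, 1).
apply: (@closed_solvesP (gs x1).1 _ [:: (gs x1).2; x1; (gs x1).1]).
have: all (fun l1 => all (fun l2 => all (fun l3 =>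
  all (fun x1 => all (fun x2 => all (fun x3 => ~~ ((l1 == l2) && (l2 == l3)) ==>
  closed_solves (gs x1).1 [:: inr (l1, x1); inr (l2, x2); inr (l3, x3)]
    [:: (gs x1).2; x1; (gs x1).1])
  kinds) kinds) kinds) bools) bools) bools by vm_compute.
move=> /allP/(_ l1 (in_bools l1))/allP/(_ l2 (in_bools l2))/allP/(_ l3 (in_bools l3)).
by move=> /allP/(_ x1 h1)/allP/(_ x2 h2)/allP/(_ x3 h3)/implyP/(_ nae_l).
Qed.

Lemma solvable_cat g1 g2 g3 p1 p2 q1 q2 ds1 ds2 :
  solvable g1 g2 p1 q1 ds1 -> solvable g2 g3 p2 q2 ds2 ->
  solvable g1 g3 (p1 + p2) (q1 + q2) (ds1 ++ ds2).
Proof.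
case=> s1 [<- val1 out1 le1] [s2 [<- val2 out2 le2]].
exists (s1 ++ s2); rewrite map_cat valid_cat val1 out1 val2 out_cat out1 out2.
split=> //; rewrite cost_cat out1 addnACA.
apply: leq_trans (leq_add le1 le2) _; rewrite addnACA leq_add2r.
by rewrite -[in gain g2 s2]out1 gain_cat.
Qed.

Lemma solvable_cancel g1 g2 p q ds : q <= p ->
  solvable g1 g2 p q ds -> solvable g1 g2 0 0 ds.
Proof.
move=> le_qp [s [eq_ds val_s out_s le_s]]; exists s; split=> //.
by rewrite !addn0 -(leq_add2r q); apply: leq_trans le_s; rewrite leq_add2l.
Qed.

End WordColours.

(** * Cutting words into tokens *)

Section Plans.
Variables (L : finType) (kd : L -> option nat).

Definition isV l := kd l == None.

Inductive token :=
| TK of L | TVV of L & L | TVKV of L & L & L | TVKK of L & L & L | TVK of L & L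
| TVVKV of L & L & L & L | TVVVVV of L & L & L & L & L.

Implicit Types (t : token) (ts : seq token).

Definition letters t : seq L :=
  match t with
  | TK k => [:: k]
  | TVV a b => [:: a; b]
  | TVKV a k b => [:: a; k; b]
  | TVKK a k k' => [:: a; k; k']
  | TVK a k => [:: a; k]
  | TVVKV a b k c => [:: a; b; k; c]
  | TVVVVV a b c d e => [:: a; b; c; d; e]
  end.

Definition token_shape t : seq bool :=
  match t with
  | TK _ => [:: false]
  | TVV _ _ => [:: true; true]
  | TVKV _ _ _ => [:: true; false; true]
  | TVKK _ _ _ => [:: true; false; false]
  | TVK _ _ => [:: true; false]
  | TVVKV _ _ _ _ => [:: true; true; false; true]
  | TVVVVV _ _ _ _ _ => [:: true; true; true; true; true]
  end.

Definition well_shaped t : bool := map isV (letters t) == token_shape t.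

Definition credit t : nat := if t is TVKV _ _ _ then 1 else 0.
Definition debit t : nat := if t is TVK _ _ then 1 else 0.

Definition forbidden t : seq (L * L) :=
  match t with
  | TVKV a k _ | TVKK a k _ | TVK a k | TVVKV _ _ k a => [:: (a, k)]
  | _ => [::]
  end.

(* The gap before a token starting with V has the colour in {3, 4} which is not
   the leg colour of [entry]; the gap after it is free, unless [exit] is defined,
   in which case it is determined in the same way by [exit]. *)
Definition entry t : option L :=
  match t with
  | TK _ => None
  | TVV a _ | TVKV a _ _ | TVKK a _ _ | TVK a _
  | TVVKV a _ _ _ | TVVVVV a _ _ _ _ => Some a
  end.

Definition exit t : option L :=
  match t with
  | TVV _ b | TVKV _ _ b | TVVKV _ _ _ b | TVVVVV _ _ _ _ b => Some b
  | _ => None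
  end.

Definition inner_links (x : L -> nat) t : seq (L * L) :=
  if t is TVVVVV a b c d e then [:: quint_link (x a) (x b) (x c) (x d) (x e) b c d]
  else [::].

Definition datum_of (lam : L -> bool) (x : L -> nat) (l : L) : nat + bool * nat :=
  if kd l is Some k then inl k else inr (lam l, x l).

(* The default [d] is the first entry of the whole circuit, which follows the
   last token. *)
Fixpoint next_entry (d : L) ts : L :=
  if ts is t :: ts' then odflt (next_entry d ts') (entry t) else d.

Definition exit_links (d : L) t ts : seq (L * L) :=
  if exit t is Some a then [:: (a, next_entry d ts)] else [::].

Fixpoint links (x : L -> nat) (d : L) ts : seq (L * L) :=
  if ts is t :: ts' then inner_links x t ++ exit_links d t ts' ++ links x d ts'
  else [::].

Definition avoids (x : L -> nat) (p : L * L) : bool := kd p.2 != Some (x p.1).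
Definition linked (lam : L -> bool) (p : L * L) : bool := lam p.1 == lam p.2.

Definition mixed (lam : L -> bool) (t : seq L) : bool :=
  if t is [:: a; b; c] then ~~ ((lam a == lam b) && (lam b == lam c)) else true.

Hypothesis kd_lt : forall l k, kd l = Some k -> k < 3.

Section Solve.
Variables (lam : L -> bool) (x : L -> nat).
Hypothesis x_lt : forall l, x l < 3.

Lemma datumV l : isV l = true -> datum_of lam x l = inr (lam l, x l).
Proof. by rewrite /isV /datum_of; case: (kd l). Qed.

Lemma datumK l : isV l = false -> exists2 k, kd l = Some k & datum_of lam x l = inl k.
Proof. by rewrite /isV /datum_of; case: (kd l) => // k _; exists k. Qed.

Lemma token_solvable t (g1 g2 : bool) :
  well_shaped t -> all (avoids x) (forbidden t) -> all (linked lam) (inner_links x t) ->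
  g1 = (if entry t is Some a then ~~ lam a else g2) ->
  (forall a, exit t = Some a -> g2 = ~~ lam a) ->
  solvable (legcol g1) (legcol g2) (credit t) (debit t)
    (map (datum_of lam x) (letters t)).
Proof.
rewrite /well_shaped; case: t => [k|a b|a k b|a k k'|a k|a b k c|a b c d e] /= /eqP[].
- by case/datumK=> i /kd_lt lt_i -> _ _ -> _; apply: solve_K.
- move=> /datumV-> /datumV-> _ _ -> /(_ _ erefl)->; exact: solve_VV.
- move=> /datumV-> /datumK[i ki ->] /datumV-> /andP[av _] _ -> /(_ _ erefl)->.
  by apply: solve_VKV (kd_lt ki) _ => //; apply: contraNneq av => ->; rewrite ki.
- move=> /datumV-> /datumK[i ki ->] /datumK[j /kd_lt lt_j ->] /andP[av _] _ -> _.
  by apply: solve_VKK (kd_lt ki) _ _ => //; apply: contraNneq av => ->; rewrite ki.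
- move=> /datumV-> /datumK[i ki ->] /andP[av _] _ -> _.
  by apply: solve_VK (kd_lt ki) _ => //; apply: contraNneq av => ->; rewrite ki.
- move=> /datumV-> /datumV-> /datumK[i ki ->] /datumV-> /andP[av _] _ -> /(_ _ erefl)->.
  by apply: solve_VVKV (kd_lt ki) _ => //; apply: contraNneq av => ->; rewrite ki.
move=> /datumV-> /datumV-> /datumV-> /datumV-> /datumV-> _ /andP[/eqP lk _] ->.
move=> /(_ _ erefl)->; apply: solve_VVVVV => //; move: lk.
by rewrite /quint_link; case: (quint_fit _ _ _ _ _).
Qed.

Lemma word_solvable (d : L) ts :
  all well_shaped ts -> all (avoids x) (flatten (map forbidden ts)) ->
  all (linked lam) (links x d ts) ->
  solvable (legcol (~~ lam (next_entry d ts))) (legcol (~~ lam d))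
    (sumn (map credit ts)) (sumn (map debit ts))
    (map (datum_of lam x) (flatten (map letters ts))).
Proof.
elim: ts => [_ _ _|t ts IHts] /=; first by exists [::].
case/andP=> wt wts; rewrite !all_cat => /andP[ft fts] /and3P[it et lts].
rewrite map_cat; apply: solvable_cat (IHts wts fts lts).
apply: token_solvable => //; first by case: (entry t).
by move=> a ea; move: et; rewrite /exit_links ea /= andbT => /eqP->.
Qed.

End Solve.

Inductive plan := Word of seq token | Triangle of L & L & L | Pin of L & L.

Definition plan_letters p : seq L :=
  match p with
  | Word ts => flatten (map letters ts)
  | Triangle a b c => [:: a; b; c]
  | Pin a k => [:: a; k]
  end.

Definition plan_ok p : bool :=
  match p with
  | Word ts => all well_shaped ts && (sumn (map debit ts) <= sumn (map credit ts))
  | Triangle a b c => [&& isV a, isV b & isV c]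
  | Pin a k => isV a && ~~ isV k
  end.

Definition plan_forbidden p : seq (L * L) :=
  match p with
  | Word ts => flatten (map forbidden ts)
  | Triangle _ _ _ => [::]
  | Pin a k => [:: (a, k)]
  end.

(** The last exit is linked with the first entry around the circuit, hence the default
    [next_entry d ts]. When no token has an entry, this is the arbitrary letter [d], and [lam d]
    merely selects which of 3 and 4 colours the gaps. *)
Definition plan_links (x : L -> nat) p : seq (L * L) :=
  if p is Word ts then
    if flatten (map letters ts) is d :: _ then links x (next_entry d ts) ts else [::]
  else [::].

Definition plan_triples p : seq (seq L) :=
  if p is Triangle a b c then [:: [:: a; b; c]] else [::].

Lemma next_entry_idem d ts : next_entry (next_entry d ts) ts = next_entry d ts.
Proof.
by elim: ts => //= t ts IHts; case: (entry t).
Qed.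

Lemma plan_solvable (lam : L -> bool) (x : L -> nat) p :
  (forall l, x l < 3) -> plan_ok p -> plan_letters p != [::] ->
  all (avoids x) (plan_forbidden p) -> all (linked lam) (plan_links x p) ->
  all (mixed lam) (plan_triples p) ->
  closed_solvable (map (datum_of lam x) (plan_letters p)).
Proof.
move=> x_lt; case: p => [ts|a b c|a k] /=.
- case/andP=> wts le_db; have := @word_solvable lam x x_lt _ ts wts.
  case: (flatten (map letters ts)) => // d ds slv _ av lk _.
  have := solvable_cancel le_db (slv _ av lk).
  by rewrite next_entry_idem; apply: closed_of_solvable.
- case/and3P=> /datumV-> /datumV-> /datumV-> _ _ _; rewrite andbT.
  by move=> nae_l; apply: closed_solve_VVV.
case/andP=> /datumV-> /negPf Vk _ /andP[av _] _ _.
have [i ki ->] := datumK lam x Vk.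
apply: closed_solve_VK (kd_lt ki) _ => //.
by apply: contraNneq av => ->; rewrite ki.
Qed.

Definition pair_letters (ps : seq (L * L)) : seq L := flatten [seq [:: p.1; p.2] | p <- ps].

Lemma pair_letters_cat ps qs :
  pair_letters (ps ++ qs) = pair_letters ps ++ pair_letters qs.
Proof. by rewrite /pair_letters map_cat flatten_cat. Qed.

(* Every letter occurs in at most one link: the exit of a token and the entry
   linked with it appear in this order around the circuit. *)
Lemma links_subseq x d ts :
  subseq (next_entry d ts :: pair_letters (links x d ts))
         (flatten (map letters ts) ++ [:: d]).
Proof.
elim: ts => [|t ts]; first by rewrite /= eqxx.
rewrite [links _ _ _]/= [flatten _]/= [next_entry _ _]/= !pair_letters_cat -catA.
set F := flatten _ ++ _; set Q := pair_letters (links x d ts).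
set e := next_entry d ts => sub_e.
have sub_Q : subseq Q F by exact: subseq_trans (subseq_cons _ _) sub_e.
have exitS (a b : L) s1 r : exit t = Some b -> subseq (rcons s1 b) r ->
    subseq (a :: s1 ++ pair_letters (exit_links d t ts) ++ Q) (a :: r ++ F).
  move=> et sub_s; rewrite /exit_links et /= eqxx -/e.
  by have := cat_subseq sub_s sub_e; rewrite cat_rcons.
have exitN (a : L) r : exit t = None ->
    subseq (a :: pair_letters (exit_links d t ts) ++ Q) (a :: r ++ F).
  move=> et; rewrite /exit_links et /= eqxx.
  by apply: subseq_trans sub_Q (suffix_subseq _ _).
case: t exitS exitN => [k|a b|a k b|a k k'|a k|a b k c|a b c e1 f] exitS exitN.
- exact: subseq_trans sub_e (subseq_cons _ _).
- by apply: (exitS a b [::] [:: b]) => //=; rewrite eqxx.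
- by apply: (exitS a b [::] [:: k; b]); rewrite // sub1seq !inE eqxx orbT.
- exact: (exitN a [:: k; k']).
- exact: (exitN a [:: k]).
- by apply: (exitS a c [::] [:: b; k; c]); rewrite // sub1seq !inE eqxx !orbT.
rewrite /inner_links /quint_link.
case: (quint_fit _ _ _ _ _) => [|_ _].
  apply: (exitS a f [:: c; e1] [:: b; c; e1; f]) => //.
  by apply: subseq_trans (subseq_cons _ _) => /=; rewrite !eqxx.
apply: (exitS a f [:: b; c] [:: b; c; e1; f]) => //.
by rewrite /= !eqxx; case: eqP => //= _; rewrite eqxx.
Qed.

(** The final [d] is the first entry met again after a full turn. Once the leading [d] is matched
    inside [F], only the letters of [F] after it and the final [d] remain, and these are
    distinct. *)
Lemma uniq_of_subseq_rcons (T : eqType) (d : T) s F : uniq F -> d \in F ->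
  subseq (d :: s) (F ++ [:: d]) -> uniq s /\ {subset s <= F}.
Proof.
move=> uF /splitPr def_F; case: def_F uF => F1 F2.
rewrite cat_uniq /= negb_or => /and3P[_ /andP[nd1 _] /andP[nd2 uF2]] sub_s.
have {}sub_s : subseq s (F2 ++ [:: d]).
  elim: F1 nd1 sub_s => [|y F1 IHF] /=; first by rewrite eqxx.
  by rewrite inE negb_or => /andP[/negPf->] /IHF.
split; last first.
  by move=> y /(mem_subseq sub_s); rewrite !mem_cat !inE orbC; case/orP=> ->; rewrite ?orbT.
by apply: subseq_uniq sub_s _; rewrite cats1 rcons_uniq nd2.
Qed.

Lemma next_entry_mem d ts : d \in flatten (map letters ts) ->
  next_entry d ts \in flatten (map letters ts).
Proof.
move=> dF; have: (next_entry d ts == d) || (next_entry d ts \in flatten (map letters ts)).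
  elim: ts {dF} => [|t ts IHts] /=; first by rewrite eqxx.
  rewrite mem_cat; case/orP: IHts => [/eqP|] IH.
    by case: t => *; rewrite /= ?inE ?eqxx ?orbT // IH eqxx.
  by case: t => *; rewrite /= ?IH ?inE ?eqxx ?orbT.
by case/orP => [/eqP->|].
Qed.

Lemma plan_links_uniq x p : uniq (plan_letters p) ->
  uniq (pair_letters (plan_links x p)) /\
  {subset pair_letters (plan_links x p) <= plan_letters p}.
Proof.
case: p => [ts|//|//] uF; rewrite /plan_links /=.
case def_F: (flatten _) => [|d0 F] //; rewrite -def_F in uF *.
apply: uniq_of_subseq_rcons (next_entry d0 ts) _ _ uF _ _.
  by apply: next_entry_mem; rewrite def_F mem_head.
rewrite -[X in X :: _](next_entry_idem d0 ts); exact: links_subseq.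
Qed.

Lemma token_forbidden_uniq t :
  uniq (map fst (forbidden t)) /\ {subset map fst (forbidden t) <= letters t}.
Proof.
by case: t => *; split=> //= y; rewrite !inE // => /eqP->; rewrite eqxx ?orbT.
Qed.

Lemma uniq_flatten_sub (T : Type) (f g : T -> seq L) (ps : seq T) :
  (forall p, uniq (f p) -> uniq (g p) /\ {subset g p <= f p}) ->
  uniq (flatten (map f ps)) ->
  uniq (flatten (map g ps)) /\ {subset flatten (map g ps) <= flatten (map f ps)}.
Proof.
move=> gP; elim: ps => //= p ps IHps; rewrite !cat_uniq => /and3P[up dis ups].
have [ug sg] := gP p up; have [ugs sgs] := IHps ups.
split; last by move=> y; rewrite !mem_cat => /orP[/sg->|/sgs->]; rewrite ?orbT.
rewrite ug ugs andbT; apply: contra dis => /hasP[y /sgs y1 /sg y2].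
by apply/hasP; exists y.
Qed.

Lemma plan_forbidden_uniq p : uniq (plan_letters p) ->
  uniq (map fst (plan_forbidden p)) /\
  {subset map fst (plan_forbidden p) <= plan_letters p}.
Proof.
case: p => [ts|//|a k] /=; last by split=> // y; rewrite !inE => ->.
move=> uts; rewrite map_flatten -map_comp.
exact: uniq_flatten_sub (fun t _ => token_forbidden_uniq t) uts.
Qed.

End Plans.

(** * Types and leg colours *)

Section Assignment.
Variables (L : finType) (kd : L -> option nat) (f : L -> L).
Hypothesis kd_lt : forall l k, kd l = Some k -> k < 3.
Hypothesis f_inv : involutive f.

Lemma exists_types (F : seq (L * L)) : uniq (map fst F) ->
  exists x : L -> nat, [/\ forall l, x l < 3, forall l, x (f l) = x l & all (avoids kd x) F].
Proof.
move=> uF.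
(* The value 3 is no type, so it stands for the absence of a constraint at [l]. *)
pose fb l := if [seq p <- F | p.1 == l] is p :: _ then odflt 3 (kd p.2) else 3.
pose used l m := (fb l == m) || (fb (f l) == m).
pose x l := if ~~ used l 0 then 0 else if ~~ used l 1 then 1 else 2.
have xP l : ~~ used l (x l).
  rewrite /x; case u0: (used l 0) => /=; last by rewrite u0.
  case u1: (used l 1) => /=; last by rewrite u1.
  move: u0 u1; rewrite /used; move: (fb l) (fb (f l)) => p q.
  by case: p => [|[|[|p]]]; case: q => [|[|[|q]]].
exists x; split=> [l|l|]; first by rewrite /x; case: ifP => // _; case: ifP.
  by rewrite /x /used f_inv; rewrite (orbC (_ == 0)) (orbC (_ == 1)).
apply/allP=> p pF; rewrite /avoids; apply/eqP => kp.
have := xP p.1; rewrite /used negb_or => /andP[/negP[]]; rewrite /fb.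
have : p \in [seq q <- F | q.1 == p.1] by rewrite mem_filter eqxx.
have : uniq (map fst [seq q <- F | q.1 == p.1]).
  by apply: subseq_uniq uF; apply: map_subseq; apply: filter_subseq.
have : all (fun q => q.1 == p.1) [seq q <- F | q.1 == p.1] by apply: filter_all.
case: [seq q <- F | _] => [|q [|r s]] //=; last first.
  by case/and3P=> /eqP-> /eqP-> _; rewrite inE eqxx.
by move=> _ _; rewrite inE => /eqP<-; rewrite kp.
Qed.

(* The edge of E_3 with ends [l] and [f l], as a propositional variable. *)
Let v l : {set L} := [set l; f l].

Lemma count_class_le (s : seq L) (X : {set L}) : uniq s -> count_mem X (map v s) <= 2.
Proof.
move=> us; rewrite count_map -size_filter.
have sP l : l \in [seq l <- s | v l == X] -> v l = X.
  by rewrite mem_filter => /andP[/eqP].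
have us' := filter_uniq (fun l => v l == X) us.
have -> : [seq l <- s | preim v (pred1 X) l] = [seq l <- s | v l == X] by [].
case def_s : [seq l <- s | v l == X] => [|l r] //; rewrite -def_s.
have vl : v l = X by apply: sP; rewrite def_s mem_head.
apply: (@leq_trans #|v l|); last by rewrite cards2; case: (_ != _).
rewrite cardE; apply: uniq_leq_size us' _ => m /sP vm.
by rewrite mem_enum vl -vm !inE eqxx.
Qed.

Lemma exists_legs (E : seq (L * L)) (T : seq (seq L)) :
  uniq (pair_letters E ++ flatten T) -> (forall t, t \in T -> size t = 3) ->
  exists lam : L -> bool, [/\ forall l, lam (f l) = lam l, all (linked lam) E
    & all (mixed lam) T].
Proof.
move=> uET sz3.
pose es := [seq (v p.1, v p.2) | p <- E].
pose ts := [seq [seq (v l, false) | l <- t] | t <- T].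
have [||a] := @nae_solve _ es ts.
- by move=> _ /mapP[t tT ->]; rewrite size_map sz3.
- move=> X; rewrite /occ flatten_cat map_cat.
  have -> : map fst (flatten (map (@eq_clause _) es)) = map v (pair_letters E).
    by rewrite /es /pair_letters; elim: E {uET es} => //= p E ->.
  have -> : map fst (flatten ts) = map v (flatten T).
    rewrite /ts; elim: T {uET sz3 ts} => //= t T IHT.
    by rewrite !map_cat IHT -map_comp.
  by rewrite -map_cat count_class_le.
rewrite all_cat => /andP[/allP aE /allP aT]; exists (a \o v); split.
- by move=> l; rewrite /= /v f_inv setUC.
- apply/allP=> p pE; have := aE _ (map_f _ (map_f (fun p => (v p.1, v p.2)) pE)).
  by rewrite nae_eq_clause.
apply/allP=> [[|x [|y [|z []]]]] //.
move=> /(map_f (fun t => [seq (v l, false) | l <- t]))/aT.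
by rewrite /nae /lit /=; case: (a _) (a _) (a _) => [] [] [].
Qed.

Lemma plans_solvable (ps : seq (plan L)) :
  uniq (flatten (map (@plan_letters _) ps)) -> all (plan_ok kd) ps ->
  all (fun p => plan_letters p != [::]) ps ->
  exists lam x, [/\ forall l, x l < 3, forall l, x (f l) = x l, forall l, lam (f l) = lam l
    & forall w, w \in map (@plan_letters _) ps -> closed_solvable (map (datum_of kd lam x) w)].
Proof.
move=> ups okp nep.
have [|x [x_lt xf avF]] := @exists_types (flatten (map (@plan_forbidden _) ps)).
  rewrite map_flatten -map_comp.
  by case: (uniq_flatten_sub (@plan_forbidden_uniq _) ups).
pose g p := pair_letters (plan_links x p) ++ flatten (plan_triples p).
have gP p : uniq (plan_letters p) -> uniq (g p) /\ {subset g p <= plan_letters p}.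
  case: p => [ts|a b c|//] up; rewrite /g /=; last by split.
  by rewrite cats0; apply: (plan_links_uniq x (p := Word ts)).
have [ug _] := uniq_flatten_sub gP ups.
have perm_g : perm_eq (flatten (map g ps))
    (pair_letters (flatten (map (plan_links x) ps)) ++ flatten (flatten (map (@plan_triples _) ps))).
  elim: ps {ups okp nep avF ug} => //= p ps; rewrite pair_letters_cat flatten_cat.
  rewrite -(perm_cat2l (g p)) => /perm_trans; apply; rewrite /g.
  by rewrite perm_catACA.
rewrite (perm_uniq perm_g) in ug.
have [|lam [lamf lkE naeT]] := exists_legs ug.
  move=> t; elim: ps {ups okp nep avF gP ug perm_g} => //= p ps IHps.
  by rewrite mem_cat => /orP[|//]; case: p => //= a b c; rewrite inE => /eqP->.
exists lam, x; split=> // w /(nthP [::])[i]; rewrite size_map => lti <-.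
have p0 : plan L by apply: Word [::].
rewrite (nth_map p0) //.
have all_flat (U : Type) (P : pred U) (h : plan L -> seq U) :
    all P (flatten (map h ps)) -> all P (h (nth p0 ps i)).
  move=> all_P; have: all (fun p => all P (h p)) ps.
    by elim: (ps) all_P => //= p r IHr; rewrite all_cat => /andP[-> /IHr].
  by move/(all_nthP p0)/(_ i lti).
apply: plan_solvable => //.
- exact: (elimT (all_nthP p0) okp).
- exact: (elimT (all_nthP p0) nep).
- exact: all_flat avF.
- exact: all_flat lkE.
exact: all_flat naeT.
Qed.

End Assignment.

(** * Finding a plan for every circuit *)

Section Parsing.
Variables (L : finType) (kd : L -> option nat).
Notation isV := (isV kd).
Notation tletters ts := (flatten (map (@letters L) ts)).

Let e : rel L := fun a b => isV a || isV b.

(** Reading greedily from the left, a V and the next one or two letters always complete VV, VKV or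
    VKK, so at most two letters are left over. Among the tokens used, only VKK has an odd number of
    letters V, and it cannot arise when no two letters K are adjacent. *)
Lemma parse w : exists ts r,
  [/\ all (well_shaped kd) ts, sumn (map (@debit L) ts) = 0, w = tletters ts ++ r,
      [\/ r = [::], exists2 a, isV a & r = [:: a]
        | exists a k, [/\ isV a, isV k = false & r = [:: a; k]]]
    & sorted e w -> odd (count isV w) = (r != [::])].
Proof.
have [n] := ubnP (size w); elim: n w => // n IHn w; rewrite ltnS => szw.
have step t w' : w = letters t ++ w' -> well_shaped kd t -> debit t = 0 ->
    (sorted e w -> ~~ odd (count isV (letters t))) -> exists ts r,
  [/\ all (well_shaped kd) ts, sumn (map (@debit L) ts) = 0, w = tletters ts ++ r,
      [\/ r = [::], exists2 a, isV a & r = [:: a]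
        | exists a k, [/\ isV a, isV k = false & r = [:: a; k]]]
    & sorted e w -> odd (count isV w) = (r != [::])].
  move=> def_w wt dt evt; have [|ts [r [wts dts def_w' rP oddP]]] := IHn w'.
    apply: leq_trans szw; rewrite def_w size_cat -[X in X < _]add0n ltn_add2r.
    by case: (t).
  exists (t :: ts), r; split; rewrite /= ?wt ?dt ?dts //; first by rewrite def_w def_w' catA.
  move=> sw; rewrite def_w count_cat oddD (negPf (evt sw)) /=.
  by apply: oddP; move: sw; rewrite def_w => /cat_sorted2[].
case: w szw step => [|a w1] szw step; first by exists [::], [::]; split=> //; apply: Or31.
case Va: (isV a); last first.
  by apply: (step (TK a) w1); rewrite /well_shaped //= Va.
case: w1 szw step => [|b w2] szw step.
  by exists [::], [:: a]; split; rewrite /= ?Va //; apply: Or32; exists a.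
case Vb: (isV b).
  by apply: (step (TVV a b) w2); rewrite /well_shaped //= Va Vb.
case: w2 szw step => [|c w3] szw step.
  by exists [::], [:: a; b]; split; rewrite /= ?Va ?Vb //; apply: Or33; exists a, b.
case Vc: (isV c).
  by apply: (step (TVKV a b c) w3); rewrite /well_shaped //= Va Vb Vc.
apply: (step (TVKK a b c) w3); rewrite /well_shaped //= ?Va ?Vb ?Vc //.
by rewrite /e Va Vb Vc.
Qed.

Lemma parse_even w : sorted e w -> ~~ odd (count isV w) -> exists ts,
  [/\ all (well_shaped kd) ts, sumn (map (@debit L) ts) = 0 & w = tletters ts].
Proof.
move=> sw ew; have [ts [r [wts dts def_w _ /(_ sw)]]] := parse w.
rewrite (negPf ew); case: r def_w => // def_w _; exists ts; split=> //.
by rewrite def_w cats0.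
Qed.

Lemma not_path_split (T : eqType) (r : rel T) x s : ~~ path r x s ->
  exists s1 y z s2, x :: s = s1 ++ [:: y, z & s2] /\ ~~ r y z.
Proof.
elim: s x => //= y s IHs x; rewrite negb_and; case: (boolP (r x y)) => [_ /= /IHs|rxy _].
  by case=> s1 [y1 [z1 [s2 [-> ryz]]]]; exists (x :: s1), y1, z1, s2.
by exists [::], x, y, s.
Qed.

Lemma not_cycle_rot (T : eqType) (r : rel T) w : ~~ cycle r w ->
  (exists2 x, w = [:: x] & ~~ r x x) \/
  exists i u y z, rot i w = u ++ [:: y; z] /\ ~~ r y z.
Proof.
case: w => // x p /not_path_split[s1 [y [z [s2 [def_w ryz]]]]].
case/lastP: s2 def_w => [|s2 t].
  rewrite -rcons_cons -[[:: y; z]]/([:: y] ++ [:: z]) catA !cats1.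
  move=> /rcons_inj-[def_w eq_z]; rewrite -{}eq_z in ryz.
  case: s1 def_w => [|x1 s1] /= [eq_x ->].
    by left; exists x; rewrite // -?eq_x // {1}eq_x.
  right; exists 1, s1, y, x; split=> //.
  by rewrite rot1_cons -!cats1 -catA.
rewrite -!rcons_cons -rcons_cat => /rcons_inj-[def_w _]; right.
exists (size (s1 ++ [:: y; z])), (s2 ++ s1), y, z; split=> //.
rewrite def_w (_ : s1 ++ [:: y, z & s2] = (s1 ++ [:: y; z]) ++ s2); last by rewrite -catA.
by rewrite rot_size_cat catA.
Qed.

Definition has_plan (w : seq L) :=
  exists p i, plan_ok kd p /\ plan_letters p = rot i w.

Lemma has_plan_rot i w : has_plan (rot i w) -> has_plan w.
Proof. by case=> p [j [okp eq_p]]; exists p, (rot_add w i j); rewrite -rot_rot_add. Qed.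

Lemma first_false (T : Type) (P : pred T) a b s : P a -> P b -> has (predC P) s ->
  exists s1 a' b' k s2, [/\ [:: a, b & s] = s1 ++ [:: a', b', k & s2], P a', P b' & ~~ P k].
Proof.
elim: s a b => //= c s IHs a b Pa Pb; case: (boolP (P c)) => [Pc /= hs | nPc _].
  by have [s1 [a' [b' [k [s2 [-> ? ? ?]]]]]] := IHs b c Pb Pc hs; exists (a :: s1), a', b', k, s2.
by exists [::], a, b, c, s.
Qed.

(* If two letters K are cyclically consecutive, cut after them: a last unpaired
   V is absorbed by VKK.  Otherwise only an odd number of letters V is a problem;
   it is solved by VVKV, by a VKV paying for VK, or by five consecutive V. *)
Lemma cycle_has_plan w : w != [::] -> (forall a, w = [:: a] -> ~~ isV a) -> has_plan w.
Proof.
move=> w0 w1; case: (boolP (cycle e w)) => [cw | /not_cycle_rot]; last first.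
  case=> [[x def_w nxx]|[i [u [y [z [def_w]]]]]].
    exists (Word [:: TK x]), 0; split; last by rewrite rot0 def_w.
    by move: nxx; rewrite /e orbb /= /well_shaped /= => /negPf->.
  rewrite negb_or => /andP[/negPf ny /negPf nz]; apply: (@has_plan_rot i); rewrite def_w.
  have [ts [r [wts dts -> rP _]]] := parse u.
  have ok ts' : all (well_shaped kd) ts' -> sumn (map (@debit L) ts') = 0 ->
      tletters ts' = r ++ [:: y; z] -> has_plan ((tletters ts ++ r) ++ [:: y; z]).
    move=> wts' dts' def_r; exists (Word (ts ++ ts')), 0; split.
      by rewrite /= all_cat wts wts' map_cat sumn_cat dts dts'.
    by rewrite rot0 /= map_cat flatten_cat def_r catA.
  case: rP ok => [->|[a Va ->]|[a [b [Va Vb ->]]]] ok.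
  - by apply: (ok [:: TK y; TK z]); rewrite //= /well_shaped /= ny nz.
  - by apply: (ok [:: TVKK a y z]); rewrite //= /well_shaped /= Va ny nz.
  by apply: (ok [:: TVKK a b y; TK z]); rewrite //= /well_shaped /= Va Vb ny nz.
have sorted_cycle s : cycle e s -> sorted e s.
  by case: s => //= x p; rewrite rcons_path => /andP[].
case: (boolP (odd (count isV w))) => [odd_w|even_w]; last first.
  have [ts [wts dts ->]] := parse_even (sorted_cycle _ cw) even_w.
  by exists (Word ts), 0; rewrite rot0 /= wts dts.
case: (boolP (all isV w)) => [allV|]; last first.
  rewrite -has_predC => /hasP[k kw /= nk].
  have [u [i def_w]] : exists u i, rot i w = u ++ [:: k].
    case/splitPr: kw => p1 p2; exists (p2 ++ p1), (size (rcons p1 k)).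
    by rewrite -cat_rcons rot_size_cat -cats1 catA.
  apply: (@has_plan_rot i); rewrite def_w.
  rewrite -(rot_cycle i) def_w in cw; move: odd_w.
  have -> : count isV w = count isV (u ++ [:: k]).
    by rewrite -def_w; apply/esym/permP; rewrite perm_rot.
  rewrite count_cat /= (negPf nk) !addn0 => odd_u.
  case: u odd_u cw {def_w} => [|a u] // odd_u cw.
  have Va : isV a.
    move: cw => /=; rewrite rcons_path cats1 rcons_path last_rcons => /andP[_].
    by rewrite /e (negPf nk).
  rewrite /= Va /= in odd_u.
  case: u odd_u cw => [|b u] odd_u cw.
    by exists (Pin a k), 0; rewrite rot0 /= Va nk.
  move: odd_u; rewrite /=; case Vb: (isV b) => /= odd_u; last first.
    case: u odd_u cw => [|c u] odd_u cw.
      by move: cw; rewrite /= /e Vb (negPf nk) !andbF.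
    have Vc : isV c by move: cw => /= /and3P[_ + _]; rewrite /e Vb.
    have su : sorted e (u ++ [:: k]).
      by move: cw => /= /and3P[_ _]; rewrite rcons_path => /andP[/path_sorted].
    have [ts [r [wts dts def_u rP /(_ su)]]] := parse (u ++ [:: k]).
    rewrite count_cat /= (negPf nk) !addn0.
    have -> : odd (count isV u) by move: odd_u; rewrite /= Vc add0n /= negbK.
    move=> /esym r0.
    have {r0 rP} [d [Vd def_r]] : exists d, isV d /\ r = [:: d; k].
      have : last k (tletters ts ++ r) = k by rewrite -def_u last_cat.
      case: rP r0 => [->//|[d Vd ->] _|[d [m [Vd _ ->]]] _]; rewrite last_cat /= => eq_k.
        by rewrite -eq_k Vd in nk.
      by exists d; rewrite eq_k.
    (* The unpaired V stands right before the final K, and the credit of the leading VKV pays the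
       debit of this VK. *)
    exists (Word (TVKV a b c :: ts ++ [:: TVK d k])), 0; split; last first.
      by rewrite rot0 /= map_cat flatten_cat /= -def_r -def_u.
    rewrite /= all_cat wts /well_shaped /= Va Vb Vc Vd (negPf nk) /=.
    by rewrite map_cat sumn_cat dts.
  (* The first K after the initial VV is preceded by two letters V, and followed by a third since no
     two letters K are adjacent. Taking VVKV there leaves an even number of letters V. *)
  have [|s1 [a' [b' [k' [s2 [def_s Va' Vb' nk']]]]]] :=
      @first_false _ isV a b (u ++ [:: k]) Va Vb.
    by rewrite has_cat /= nk orbT.
  move: cw; rewrite -[_ ++ [:: k]]/([:: a, b & u ++ [:: k]]) def_s => cw.
  apply: (@has_plan_rot (size s1)); rewrite rot_size_cat.
  rewrite -(rot_cycle (size s1)) rot_size_cat in cw.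
  have {odd_u} : odd (count isV (s2 ++ s1)).
    have /(congr1 (count isV)) := def_s.
    rewrite /= Va Vb !count_cat /= Va' Vb' (negPf nk) (negPf nk') !add0n !addn0.
    by rewrite !add1n !addnS addnC => -[<-]; move: odd_u; rewrite add0n /= negbK.
  move: cw; rewrite [_ ++ s1]/=; case: (s2 ++ s1) => // c r cw odd_cr.
  have Vc : isV c by move: cw => /= /and4P[_ _ + _]; rewrite /e (negPf nk').
  have sr : sorted e r.
    by move: cw => /= /and4P[_ _ _]; rewrite rcons_path => /andP[/path_sorted].
  have [|ts [wts dts def_r]] := parse_even sr; first by move: odd_cr; rewrite /= Vc.
  exists (Word (TVVKV a' b' k' c :: ts)), 0; rewrite rot0 /= -def_r; split=> //.
  by rewrite /well_shaped /= Va' Vb' (negPf nk') Vc wts dts.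
case: w w0 w1 cw odd_w allV => [|a [|b [|c [|d [|f w]]]]] // _ w1 cw odd_w /=.
- by rewrite andbT => Va; have := w1 a erefl; rewrite Va.
- by case/and3P=> Va Vb _; rewrite /= Va Vb in odd_w.
- case/and4P=> Va Vb Vc _; exists (Triangle a b c), 0.
  by rewrite rot0 /= Va Vb Vc.
- by case/and5P=> Va Vb Vc Vd _; rewrite /= Va Vb Vc Vd in odd_w.
case/and5P=> Va Vb Vc Vd /andP[Vf Vw].
have sw : sorted e w.
  by move: (sorted_cycle _ cw) => /= /and5P[_ _ _ _ /path_sorted].
have [|ts [wts dts def_w]] := parse_even sw.
  by move: odd_w; rewrite /= Va Vb Vc Vd Vf /= !negbK.
exists (Word (TVVVVV a b c d f :: ts)), 0; rewrite rot0 /= -def_w; split=> //.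
by rewrite /well_shaped /= Va Vb Vc Vd Vf wts dts.
Qed.

End Parsing.

(** * Colouring all circuits *)

Section Circuits.
Variables (L : finType) (kd : L -> option nat) (f nx : L -> L).
Hypothesis kd_lt : forall l k, kd l = Some k -> k < 3.
Hypothesis f_inv : involutive f.
Hypothesis nx_inj : injective nx.
Hypothesis nx_neq : forall l, isV kd l -> nx l != l.

Lemma circuits_exist : exists ws : seq (seq L),
  [/\ all (fcycle nx) ws, all (fun w => w != [::]) ws & perm_eq (flatten ws) (enum L)].
Proof.
have symf : connect_sym (frel nx) by apply: fconnect_sym.
exists [seq orbit nx x | x <- enum (froots nx)]; split.
- by apply/allP=> _ /mapP[x _ ->]; apply: cycle_orbit.
- by apply/allP=> _ /mapP[x _ ->]; rewrite /orbit -orderSpred.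
apply: uniq_perm; last 2 first.
- exact: enum_uniq.
- move=> y; rewrite mem_enum inE; apply/flattenP; exists (orbit nx (froot nx y)).
    by rewrite map_f // mem_enum; apply: roots_root.
  by rewrite -fconnect_orbit symf connect_root.
have: {subset enum (froots nx) <= froots nx} by move=> x; rewrite mem_enum.
elim: (enum _) (enum_uniq (froots nx)) => //= x s IHs /andP[xs us] sub_s.
rewrite cat_uniq orbit_uniq IHs //; last by move=> y ys; rewrite sub_s // inE ys orbT.
rewrite andbT; apply: contra xs => /hasP[z /flattenP[_ /mapP[y ys ->]]].
rewrite -!fconnect_orbit => yz xz.
have /eqP rx : froots nx x by apply: sub_s; rewrite mem_head.
have /eqP ry : froots nx y by apply: sub_s; rewrite inE ys orbT.
by rewrite -rx (rootP symf (_ : connect (frel nx) x y)) ?ry // (connect_trans xz) // symf.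
Qed.

Section FixedSpec.
Variables (lam : L -> bool) (x : L -> nat).
Let d := datum_of kd lam x.
Implicit Types (c : L -> nat * nat).

(** Since [c l] colours the gap after the letter [l], the cost of a letter is indexed by its
    predecessor, whose gap comes before it; [circuit_gain] at [l] concerns the gap after [l]
    itself. *)
Definition circuit_cost c l : nat := letter_cost (c l).1 (d (nx l)) (c (nx l)).
Definition circuit_gain c l : bool :=
  gap_normal (c (finv nx l)).1 (d l, c l) (d (nx l), c (nx l)).
Definition circuit_fits c l : bool := fits (c l).1 (d (nx l)) (c (nx l)).

Lemma path_cost c p s : fpath nx p s ->
  cost (c p).1 [seq (d l, c l) | l <- s] = \sum_(l <- belast p s) circuit_cost c l.
Proof.
elim: s p => [|l s IHs] p /=; first by rewrite big_nil.
by case/andP=> /eqP nxp /IHs->; rewrite big_cons /circuit_cost nxp.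
Qed.

Lemma path_valid c p s : fpath nx p s ->
  valid (c p).1 [seq (d l, c l) | l <- s] = all (circuit_fits c) (belast p s).
Proof.
elim: s p => [|l s IHs] p //= /andP[/eqP nxp /IHs->].
by rewrite /circuit_fits nxp.
Qed.

Lemma path_gain c p s : fpath nx p s ->
  gain_on (c p).1 [seq (d l, c l) | l <- s] (d (nx (last p s)), c (nx (last p s)))
  = \sum_(l <- s) circuit_gain c l.
Proof.
elim: s p => [|l s IHs] p /=; first by rewrite big_nil.
case/andP=> /eqP nxp pth; rewrite (IHs _ pth) big_cons; congr (_ + _).
rewrite /circuit_gain -nxp finv_f // nxp.
by case: s pth {IHs} => //= m s /andP[/eqP->].
Qed.

Lemma circuit_colouring w : w != [::] -> uniq w -> fcycle nx w ->
  closed_solvable (map d w) ->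
  exists c, all (circuit_fits c) w /\
    \sum_(l <- w) circuit_cost c l <= \sum_(l <- w) circuit_gain c l.
Proof.
case: w => // l0 w _ uw cw [gin [s [b [eq_d val_s out_s le_s]]]].
pose t := b :: s; rewrite -/t in eq_d val_s out_s le_s.
have szt : size t = size (l0 :: w) by have /(congr1 size) := eq_d; rewrite !size_map.
pose c l := (nth b t (index l (l0 :: w))).2.
have def_t : t = [seq (d l, c l) | l <- l0 :: w].
  apply: (@eq_from_nth _ b); rewrite ?size_map // => i lti.
  rewrite (nth_map l0) -?szt // /c index_uniq -?szt //.
  rewrite [LHS]surjective_pairing; congr (_, _).
  by rewrite -(nth_map _ (d l0)) // eq_d (nth_map l0) -?szt.
(* The circuit is read from the predecessor [p] of [l0], because the gap before [l0] is coloured by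
   [c p]. *)
exists c; pose p := last l0 w.
have pth : fpath nx p (l0 :: w) by move: cw; rewrite (cycle_path l0).
have perm_w : perm_eq (belast p (l0 :: w)) (l0 :: w).
  by rewrite [belast _ _]/= [X in perm_eq _ X]lastI perm_sym perm_rcons.
have def_gin : gin = (c p).1.
  by rewrite -out_s def_t /out -map_comp /= (last_map (fun l => (c l).1)).
rewrite -(perm_all _ perm_w).
rewrite -[X in X <= _](perm_big _ perm_w).
have <- : gain_on gin t b = \sum_(l <- l0 :: w) circuit_gain c l.
  rewrite -(path_gain c pth) -def_gin -def_t; congr gain_on.
  have -> : last p (l0 :: w) = p by [].
  have -> : nx p = l0 by case/andP: pth => /eqP.
  by case: def_t.
by rewrite -(path_cost c pth) -(path_valid c pth) -def_gin -def_t.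
Qed.

Lemma circuits_colouring (ws : seq (seq L)) :
  uniq (flatten ws) -> all (fcycle nx) ws -> all (fun w => w != [::]) ws ->
  (forall w, w \in ws -> closed_solvable (map d w)) ->
  exists c, all (circuit_fits c) (flatten ws) /\
    \sum_(l <- flatten ws) circuit_cost c l <= \sum_(l <- flatten ws) circuit_gain c l.
Proof.
elim: ws => [_ _ _ _|w ws IHws] /=; first by exists (fun=> (0, 0)); rewrite !big_nil.
rewrite cat_uniq => /and3P[uw dis uws] /andP[cw cws] /andP[w0 ws0] slv.
have [c1 [fit1 le1]] := circuit_colouring w0 uw cw (slv w (mem_head _ _)).
have [w' w's|c2 [fit2 le2]] := IHws uws cws ws0.
  by apply: slv; rewrite inE w's orbT.
(* Fit, cost and gain at [l] involve only [l] and its two neighbours, which lie on the same circuit,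
   so the colourings can be glued. *)
pose c l := if l \in w then c1 l else c2 l.
have nx_w l : (nx l \in w) = (l \in w).
  apply/idP/idP => [|lw]; last exact: mem_fcycle.
  rewrite -{2}(finv_f nx_inj l) /finv; elim: (_.-1) => //= n IHn nlw.
  by apply: mem_fcycle; last exact: IHn.
have pv_w l : (finv nx l \in w) = (l \in w) by rewrite -nx_w f_finv.
have not_w l : l \in flatten ws -> (l \in w) = false.
  by move=> lws; apply: contraNF dis => lw; apply/hasP; exists l.
have c_w l : l \in w -> [/\ circuit_fits c l = circuit_fits c1 l,
    circuit_cost c l = circuit_cost c1 l & circuit_gain c l = circuit_gain c1 l].
  by move=> lw; rewrite /circuit_fits /circuit_cost /circuit_gain /c nx_w pv_w lw.
have c_ws l : l \in flatten ws -> [/\ circuit_fits c l = circuit_fits c2 l,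
    circuit_cost c l = circuit_cost c2 l & circuit_gain c l = circuit_gain c2 l].
  by move/not_w=> lw; rewrite /circuit_fits /circuit_cost /circuit_gain /c nx_w pv_w lw.
exists c; split.
  rewrite all_cat; apply/andP; split; apply/allP=> l lw.
    by have [-> _ _] := c_w l lw; apply: (allP fit1).
  by have [-> _ _] := c_ws l lw; apply: (allP fit2).
rewrite !big_cat /=; apply: leq_add.
  rewrite (eq_big_seq (circuit_cost c1)) => [|l /c_w[]//].
  by rewrite [leqRHS](eq_big_seq (fun l => nat_of_bool (circuit_gain c1 l))) => [|l /c_w[_ _ ->]].
rewrite (eq_big_seq (circuit_cost c2)) => [|l /c_ws[]//].
by rewrite [leqRHS](eq_big_seq (fun l => nat_of_bool (circuit_gain c2 l))) => [|l /c_ws[_ _ ->]].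
Qed.

End FixedSpec.

Lemma fcycle_has_plan w : w != [::] -> fcycle nx w -> has_plan kd w.
Proof.
move=> w0 cw; apply: cycle_has_plan => // a def_w; apply/negP => Va.
by move: cw; rewrite def_w /= andbT; apply/negP/nx_neq.
Qed.

Lemma circuit_plans_exist (ws : seq (seq L)) :
  all (fcycle nx) ws -> all (fun w => w != [::]) ws ->
  exists ps : seq (plan L),
    [/\ all (plan_ok kd) ps, all (fun p => plan_letters p != [::]) ps,
        all (fcycle nx) (map (@plan_letters L) ps)
      & perm_eq (flatten (map (@plan_letters L) ps)) (flatten ws)].
Proof.
elim: ws => [_ _|w ws IHws] /=; first by exists [::].
case/andP=> cw cws /andP[w0 ws0]; have [ps [ok_ps ps0 cps perm_ps]] := IHws cws ws0.
have [p [i [okp def_p]]] := fcycle_has_plan w0 cw.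
exists (p :: ps); rewrite /= okp ok_ps ps0 cps def_p rot_cycle cw; split=> //.
  by rewrite -size_eq0 size_rot size_eq0 w0.
by apply: perm_cat; rewrite ?perm_rot.
Qed.

Theorem core_colouring : exists lam x (c : L -> nat * nat),
  [/\ forall l, lam (f l) = lam l, forall l, x l < 3, forall l, x (f l) = x l,
      forall l, circuit_fits lam x c l
    & \sum_l circuit_cost lam x c l <= \sum_l circuit_gain lam x c l].
Proof.
have [ws [cws ws0 perm_ws]] := circuits_exist.
have [ps [ok_ps ps0 cps perm_ps]] := circuit_plans_exist cws ws0.
have perm_L := perm_trans perm_ps perm_ws.
have ups : uniq (flatten (map (@plan_letters L) ps)).
  by rewrite (perm_uniq perm_L) enum_uniq.
have [lam [x [x_lt xf lamf slv]]] := plans_solvable kd_lt f_inv ups ok_ps ps0.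
have [|c [fit_c le_c]] := circuits_colouring ups cps _ slv; first by rewrite all_map.
exists lam, x, c; split=> //.
  by move=> l; apply: (allP fit_c); rewrite (perm_mem perm_L) mem_enum.
by move: le_c; rewrite !(perm_big _ perm_L) /= !big_enum.
Qed.

End Circuits.

(** * From three 1-factors to words *)

Lemma normal_of_matched lam x a b a' b' : x < 3 -> a < 5 -> b < 5 -> a' < 5 -> b' < 5 ->
  uniq [:: a; b; legcol lam] -> uniq [:: a'; b'; legcol lam] ->
  matched x a b -> matched x a' b' -> normal_cols [:: legcol lam; a; b; a'; b'].
Proof.
move=> /in_kinds hx; have h5 i : i < 5 -> i \in iota 0 5 by rewrite mem_iota.
move=> /h5 ha /h5 hb /h5 ha' /h5 hb'.
have: all (fun lam => all (fun x => all (fun a => all (fun b =>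
    (uniq [:: a; b; legcol lam] && matched x a b) ==> all (fun a' => all (fun b' =>
    (uniq [:: a'; b'; legcol lam] && matched x a' b') ==>
    normal_cols [:: legcol lam; a; b; a'; b']) (iota 0 5)) (iota 0 5))
  (iota 0 5)) (iota 0 5)) kinds) bools by vm_compute.
move=> /allP/(_ lam (in_bools lam))/allP/(_ x hx)/allP/(_ a ha)/allP/(_ b hb)/implyP H.
move=> u u' m m'; move: (H (introT andP (conj u m))).
by move/allP/(_ a' ha')/allP/(_ b' hb')/implyP; apply; rewrite u' m'.
Qed.

Definition good_end (k a b : nat) : bool :=
  [&& a < 5, b < 5, uniq [:: k; a; b] & same_side a b].

Lemma normal_of_good_ends k a b a' b' : k < 3 -> good_end k a b -> good_end k a' b' ->
  normal_cols [:: k; a; b; a'; b'].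
Proof.
move=> /in_kinds hk; have h5 i : i < 5 -> i \in iota 0 5 by rewrite mem_iota.
move=> gab gab'; have /and3P[/h5 ha /h5 hb _] := gab; have /and3P[/h5 ha' /h5 hb' _] := gab'.
have: all (fun k => all (fun a => all (fun b => good_end k a b ==>
    all (fun a' => all (fun b' => good_end k a' b' ==>
    normal_cols [:: k; a; b; a'; b']) (iota 0 5)) (iota 0 5))
  (iota 0 5)) (iota 0 5)) kinds by vm_compute.
move=> /allP/(_ k hk)/allP/(_ a ha)/allP/(_ b hb)/implyP/(_ gab).
by move=> /allP/(_ a' ha')/allP/(_ b' hb')/implyP/(_ gab').
Qed.

(** * From natural numbers to a set of five colours *)

Section NatColouring.
Variables (G : multigraph) (phi : edge G -> nat).
Hypothesis phi_lt : forall e, phi e < 5.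

Lemma normal_inord e u w a b a' b' : ends e = [set u; w] ->
  incident u = [set e; a; b] -> incident w = [set e; a'; b'] ->
  normal_cols [:: phi e; phi a; phi b; phi a'; phi b'] ->
  normal (fun e => inord (phi e) : 'I_5) e.
Proof.
move=> def_e def_u def_w; pose s := [:: e; a; b; a'; b'].
have adjE h : ((h == e) || adjacent e h) = (h \in s).
  rewrite /adjacent; have -> : (ends e :&: ends h != set0) = (h \in s).
    have -> : (h \in s) = (h \in incident u) || (h \in incident w).
      by rewrite def_u def_w !inE; case: (h == e); case: (h == a); case: (h == b).
    apply/set0Pn/orP => [[v]|].
      rewrite def_e !inE => /andP[/orP[]/eqP-> vh]; [left|right]; by rewrite ?inE.
    by rewrite !inE => -[]; [exists u|exists w]; rewrite !inE def_e !inE eqxx ?orbT.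
  by rewrite eq_sym; case: (eqVneq e h) => //= <-; rewrite inE eqxx.
have -> : normal_cols [:: phi e; phi a; phi b; phi a'; phi b']
    = (size (undup (map phi s)) \in [:: 3; 5]) by [].
rewrite /normal /poor /rich /palette.
set A := [set _ | _ in _]; have -> : #|A| = size (undup (map phi s)).
  have -> : A = [set i in map (fun e => inord (phi e) : 'I_5) s].
    apply/setP=> i; rewrite inE; apply/imsetP/mapP => -[h hs ->].
      by exists h; rewrite // -adjE.
    by exists h; rewrite // inE adjE.
  rewrite cardsE -(eq_card (mem_undup _)) (card_uniqP (undup_uniq _)).
  have -> : map phi s = map val [seq inord (phi h) : 'I_5 | h <- s].
    by rewrite -map_comp; apply: eq_map => h; rewrite /= inordK.
  by rewrite (undup_map_inj val_inj) size_map.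
by rewrite !inE.
Qed.

Lemma proper_inord :
  (forall v, {in incident v &, injective phi}) ->
  proper_coloring (fun e => inord (phi e) : 'I_5).
Proof.
move=> phi_inj e h /andP[neq_eh /set0Pn[v]]; rewrite inE => /andP[ve vh].
apply: contraNneq neq_eh => /(congr1 val); rewrite /= !inordK // => eq_phi.
by apply/eqP/(phi_inj v); rewrite ?inE.
Qed.

End NatColouring.

(** * Alternating classes for two involutions *)

Section Alternating.
Variables (T : finType) (s t : T -> T).
Hypotheses (s_inv : involutive s) (t_inv : involutive t).
Hypotheses (s_neq : forall z, s z != z) (t_neq : forall z, t z != z).

Let r := s \o t.

Let r_inj : injective r.
Proof. exact: inj_comp (can_inj s_inv) (can_inj t_inv). Qed.

(* Conjugating by [s] inverts [r], so an orbit of [r] stable under [s] would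
   contain a fixed point of [s] or of [t]. *)
Lemma iter_neq_involution n z : iter n r z != s z.
Proof.
have [m] := ubnP n; elim: m n z => // m IHm [|[|n]] z lt_n.
- by rewrite eq_sym.
- by rewrite /= /r /= (inj_eq (can_inj s_inv)).
apply/eqP => eq_n; have: iter n r (r z) = s (r z).
  apply: r_inj; rewrite -iterS -iterSr eq_n.
  by rewrite {2}/r /= s_inv /r /= t_inv.
by apply/eqP/IHm; move: lt_n; rewrite !ltnS => /ltnW.
Qed.

(* The union of two perfect matchings is bipartite. *)
Lemma alternating_exists : exists P : pred T,
  (forall z, P (s z) = ~~ P z) /\ (forall z, P (t z) = ~~ P z).
Proof.
have symr : connect_sym (frel r) by apply: fconnect_sym.
(* Each of [s] and [t] exchanges the orbit of [z] under [r] with one and the same other orbit;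
   numbering the orbits singles out one of the two. *)
pose rk z := enum_rank (froot r z).
have rk_r z : rk (r z) = rk z.
  by rewrite /rk; congr enum_rank; apply/esym/(rootP symr); apply: fconnect1.
have rk_s z : rk (s z) != rk z :> nat.
  rewrite val_eqE (inj_eq enum_rank_inj); apply/negP => /eqP/(rootP symr).
  rewrite symr => /iter_findex; move: (findex _ _ _) => n /eqP.
  by apply/negP; apply: iter_neq_involution.
have Ps z : (rk (s z) < rk (s (s z))) = ~~ (rk z < rk (s z)).
  by rewrite s_inv -leqNgt [RHS]leq_eqVlt (negPf (rk_s z)).
exists (fun z => rk z < rk (s z)); split=> [//|z].
have -> : rk (s (t z)) = rk z by apply: rk_r.
by rewrite -Ps s_inv -(rk_r (t z)) /r /= t_inv.
Qed.

End Alternating.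

Lemma alternating_on (T : finType) (D : pred T) (s t : T -> T) :
  (forall z, D z -> [/\ D (s z), s (s z) = z & s z != z]) ->
  (forall z, D z -> [/\ D (t z), t (t z) = z & t z != z]) ->
  exists P : pred T, forall z, D z -> P (s z) = ~~ P z /\ P (t z) = ~~ P z.
Proof.
move=> sP tP.
have sD (u : {z | D z}) : D (s (val u)) by case: (sP _ (valP u)).
have tD (u : {z | D z}) : D (t (val u)) by case: (tP _ (valP u)).
have [|||| P [Ps Pt]] := @alternating_exists _
    (fun u : {z | D z} => Sub (s (val u)) (sD u)) (fun u => Sub (t (val u)) (tD u)).
- by move=> u; apply: val_inj; rewrite /=; case: (sP _ (valP u)).
- by move=> u; apply: val_inj; rewrite /=; case: (tP _ (valP u)).
- by move=> u; rewrite -val_eqE /=; case: (sP _ (valP u)).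
- by move=> u; rewrite -val_eqE /=; case: (tP _ (valP u)).
exists (fun z => if insub z is Some u then P u else false) => z Dz.
have [Dsz _ _] := sP z Dz; have [Dtz _ _] := tP z Dz.
rewrite !insubT; split; first by rewrite -(Ps (Sub z Dz)); congr P; apply: val_inj.
by rewrite -(Pt (Sub z Dz)); congr P; apply: val_inj.
Qed.

(** * Vertices relative to three 1-factors, and walks around the circuits *)

Section ThreeFactors.
Variables (G : multigraph) (S : 3.-tuple {set edge G}).
Hypotheses (cubG : cubic G) (factS : all (@one_factor G) S).
Implicit Types (e h : edge G) (u v w : vertex G).

(* [sgn e] is the indicator of the 1-factors containing e, and [mult e] the
   number of those: e lies in E_(mult e). *)
Definition sgn e : seq bool := [seq e \in (M : {set edge G}) | M <- S].
Definition mult e : nat := count (fun M : {set edge G} => e \in M) S.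

Lemma mult_sgn e : mult e = count id (sgn e).
Proof. by rewrite /mult /sgn count_map; apply: eq_count. Qed.

Definition unit_sgn k := [seq i == k | i <- iota 0 3].
Definition counit_sgn k := [seq i != k | i <- iota 0 3].

(** The 1-factors use three, two or one distinct edges at [v], so E_0 and E_2 together have 0, 2 or
    2 edges there and form circuits. In the case [Bivalent], [k] is the 1-factor missing the edge of
    E_2. *)
Variant vertex_spec v : Prop :=
| Plain a b c of incident v = [set a; b; c] & uniq [:: a; b; c]
    & sgn a = unit_sgn 0 & sgn b = unit_sgn 1 & sgn c = unit_sgn 2
| Bivalent k a b c of k < 3 & incident v = [set a; b; c] & uniq [:: a; b; c]
    & mult a = 0 & sgn b = counit_sgn k & sgn c = unit_sgn k
| Trivalent a b c of incident v = [set a; b; c] & uniq [:: a; b; c]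
    & mult a = 0 & mult b = 0 & mult c = 3.

Lemma cards3P (T : finType) (A : {set T}) x y : #|A| = 3 -> x \in A -> y \in A -> x != y ->
  exists2 z, A = [set z; x; y] & uniq [:: z; x; y].
Proof.
move=> A3 xA yA xy; have: #|A :\ x :\ y| = 1.
  by have := cardsD1 x A; rewrite A3 xA (cardsD1 y (A :\ x)) !inE eq_sym xy yA => -[].
case/eqP/cards1P=> z def_z; exists z.
  apply/setP=> t; have /setP/(_ t) := def_z; rewrite !inE => <-.
  case: (eqVneq t y) => [->|_]; first by rewrite yA orbT.
  by case: (eqVneq t x) => [->|_]; rewrite ?xA //= !orbF.
have: z \in A :\ x :\ y by rewrite def_z set11.
by rewrite /= !inE negb_or xy andbT => /and3P[-> -> _].
Qed.

Lemma vertexP v : vertex_spec v.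
Proof.
have I3 : #|incident v| = 3 by have /forallP/(_ v)/eqP := cubG.
have [m [mI mP]] : exists m : nat -> edge G,
    (forall i, i < 3 -> m i \in incident v) /\
    (forall e, e \in incident v -> sgn e = [:: e == m 0; e == m 1; e == m 2]).
  rewrite /sgn; move: factS; case: S => [[|M0 [|M1 [|M2 []]]]] //= _.
  have one (M : {set edge G}) : one_factor M -> exists2 e0, e0 \in incident v &
      forall e, e \in incident v -> (e \in M) = (e == e0).
    move/forallP/(_ v)/cards1P=> [e0 /setP def_e0]; exists e0.
      by have := def_e0 e0; rewrite !inE eqxx => /andP[].
    by move=> e eI; have := def_e0 e; rewrite !inE; move: eI; rewrite inE => ->; rewrite andbT.
  case/and4P=> /one[a aI aP] /one[b bI bP] /one[c cI cP] _.
  exists (nth c [:: a; b]); split; first by case=> [|[|[|]]].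
  by move=> e eI; rewrite aP ?bP ?cP.
have [I0 I1 I2] := And3 (mI 0 isT) (mI 1 isT) (mI 2 isT).
move: (m 0) (m 1) (m 2) I0 I1 I2 mP => a b c aI bI cI sP {m mI}.
have nI x y : x \in incident v -> y \in incident v -> x != y ->
  exists2 z, incident v = [set z; x; y] & uniq [:: z; x; y] by exact: cards3P.
have inI z x y : incident v = [set z; x; y] -> z \in incident v.
  by move->; rewrite !inE eqxx.
have bival k x y : k < 3 -> x \in incident v -> y \in incident v -> x != y ->
    sgn x = counit_sgn k -> sgn y = unit_sgn k ->
    (forall z, z \in incident v -> uniq [:: z; x; y] -> mult z = 0) -> vertex_spec v.
  move=> k3 xI yI xy sx sy m0; have [z def_v uz] := nI _ _ xI yI xy.
  by apply: (Bivalent k3 def_v uz) => //; apply: m0 (inI _ _ _ def_v) uz.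
have m0 z : z \in incident v -> z != a -> z != b -> z != c -> mult z = 0.
  by move=> zI /negPf za /negPf zb /negPf zc; rewrite mult_sgn sP //= za zb zc.
have n3 x y z : uniq [:: x; y; z] -> [/\ x != y, x != z & y != z].
  by rewrite /= !inE negb_or andbT => /andP[/andP[-> ->] ->].
case: (eqVneq a b) => [eab|nab].
  case: (eqVneq a c) => [eac|nac].
    subst b c; have : 1 < #|incident v :\ a| 
      by have := cardsD1 a (incident v); rewrite I3 aI add1n => -[<-].
    case/card_gt1P=> x [y [xI yI xy]]; move: xI yI; rewrite !inE => /andP[xa xI] /andP[ya yI].
    have {}xI : x \in incident v by rewrite inE.
    have {}yI : y \in incident v by rewrite inE.
    apply: (@Trivalent _ x y a).
    - apply/eqP; rewrite eq_sym eqEcard I3 !subUset !sub1set xI yI aI /=.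
      by rewrite setUC cardsU1 cards2 !inE negb_or xy eq_sym xa eq_sym ya.
    - by rewrite /= !inE negb_or xy xa ya.
    - exact: m0.
    - exact: m0.
    by rewrite mult_sgn sP //= eqxx.
  subst b; apply: (bival 2 a c) => //; rewrite ?sP //= ?eqxx ?(negPf nac) 1?eq_sym ?(negPf nac) //.
  by move=> z zI /n3[za zc _]; apply: m0.
case: (eqVneq a c) => [eac|nac].
  subst c; apply: (bival 1 a b) => //; rewrite ?sP //= ?eqxx ?(negPf nab) 1?eq_sym ?(negPf nab) //.
  by move=> z zI /n3[za zc _]; apply: m0.
case: (eqVneq b c) => [ebc|nbc].
  subst c; apply: (bival 0 b a); rewrite ?sP //= ?eqxx ?(negPf nab) 1?eq_sym ?(negPf nab) //.
  by move=> z zI /n3[za zc _]; apply: m0.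
have [z def_v uz] := nI _ _ bI cI nbc.
have eza : a = z.
  by move: aI; rewrite def_v !inE (negPf nab) (negPf nac) !orbF => /eqP.
subst z; apply: (Plain def_v uz); rewrite sP //= ?eqxx.
- by rewrite (negPf nab) (negPf nac).
- by rewrite eq_sym (negPf nab) (negPf nbc).
by rewrite eq_sym (negPf nac) eq_sym (negPf nbc).
Qed.

Definition opp e v : vertex G := odflt v [pick w in ends e :\ v].

Lemma oppP e v : v \in ends e ->
  [/\ ends e = [set v; opp e v], opp e v != v & opp e (opp e v) = v].
Proof.
have oppE u w : ends e = [set u; w] -> u != w -> opp e u = w.
  move=> def_e uw; rewrite /opp; case: pickP => [z|/(_ w)]; rewrite def_e !inE.
    by case: (eqVneq z u) => //= _ /eqP.
  by rewrite eq_sym uw eqxx orbT.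
move=> ve; have [u def_u uv] : exists2 u, ends e = [set v; u] & v != u.
  have /eqP/cards2P[a [b [ab def_e]]] := card_ends e.
  move: ve; rewrite def_e !inE => /orP[]/eqP->; first by exists b.
  by exists a; rewrite 1?setUC 1?eq_sym.
rewrite (oppE _ _ def_u uv) -def_u eq_sym; split=> //.
by apply: oppE; rewrite 1?setUC 1?eq_sym.
Qed.

Lemma mult_unit e k : k < 3 -> sgn e = unit_sgn k -> mult e = 1.
Proof. by rewrite mult_sgn => + ->; case: k => [|[|[|]]]. Qed.

Lemma mult_counit e k : k < 3 -> sgn e = counit_sgn k -> mult e = 2.
Proof. by rewrite mult_sgn => + ->; case: k => [|[|[|]]]. Qed.

Lemma counit_inj k k' : k < 3 -> k' < 3 -> counit_sgn k = counit_sgn k' -> k = k'.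
Proof. by case: k k' => [|[|[|]]] // [|[|[|]]]. Qed.

(* A dart is an edge of E_0 with a chosen end.  Alternating [other_end] and
   [across] walks around a circuit, [across] jumping over an edge of E_2. *)
Definition dart (z : vertex G * edge G) := (z.1 \in ends z.2) && (mult z.2 == 0).
Definition pick_mult n v : option (edge G) := [pick e in incident v | mult e == n].
Definition other_end (z : vertex G * edge G) := (opp z.2 z.1, z.2).
Definition across (z : vertex G * edge G) :=
  if pick_mult 2 z.1 is Some h then
    (opp h z.1, odflt z.2 (pick_mult 0 (opp h z.1)))
  else (z.1, odflt z.2 [pick e in incident z.1 :\ z.2 | mult e == 0]).

Lemma other_endP z : dart z ->
  [/\ dart (other_end z), other_end (other_end z) = z & other_end z != z].
Proof.
case: z => v e /andP[/= ve me]; have [def_e neq opp2] := oppP ve.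
rewrite /other_end /dart /= opp2 me def_e !inE eqxx orbT; split=> //.
by apply: contraNneq neq => -[->].
Qed.

Lemma pick_multE n v e : e \in incident v -> mult e = n ->
  (forall e', e' \in incident v -> mult e' = n -> e' = e) -> pick_mult n v = Some e.
Proof.
move=> ev me uniq_e; rewrite /pick_mult; case: pickP => [e'|/(_ e)].
  by case/andP=> e'v /eqP me'; rewrite (uniq_e e').
by rewrite ev me eqxx.
Qed.

Lemma in_set3P (T : finType) (P : T -> Prop) (a b c : T) :
  P a -> P b -> P c -> forall t, t \in [set a; b; c] -> P t.
Proof. by move=> pa pb pc t; rewrite !inE -orbA => /or3P[]/eqP->. Qed.

Lemma bivalent_picks v k a b c : k < 3 -> incident v = [set a; b; c] ->
  mult a = 0 -> sgn b = counit_sgn k -> sgn c = unit_sgn k ->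
  [/\ pick_mult 0 v = Some a, pick_mult 2 v = Some b & pick_mult 3 v = None].
Proof.
move=> k3 def_v ma sb sc; have mb := mult_counit k3 sb; have mc := mult_unit k3 sc.
split; [apply: pick_multE => // | apply: pick_multE => // |].
- by rewrite def_v !inE eqxx.
- by rewrite def_v; apply: in_set3P => //; rewrite ?mb ?mc.
- by rewrite def_v !inE eqxx orbT.
- by rewrite def_v; apply: in_set3P => //; rewrite ?ma ?mc.
rewrite /pick_mult; case: pickP => // e /andP[]; rewrite def_v; move: e.
by apply: in_set3P; rewrite ?ma ?mb ?mc.
Qed.

Lemma trivalent_picks v a b c : incident v = [set a; b; c] ->
  mult a = 0 -> mult b = 0 -> mult c = 3 ->
  pick_mult 2 v = None /\ pick_mult 3 v = Some c.
Proof.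
move=> def_v ma mb mc; split.
  rewrite /pick_mult; case: pickP => // e /andP[]; rewrite def_v; move: e.
  by apply: in_set3P; rewrite ?ma ?mb ?mc.
apply: pick_multE => //; first by rewrite def_v !inE eqxx orbT.
by rewrite def_v; apply: in_set3P => //; rewrite ?ma ?mb.
Qed.

Variant across_spec z : vertex G * edge G -> Prop :=
| Pass b f of incident z.1 = [set z.2; b; f] & uniq [:: z.2; b; f]
    & mult b = 0 & mult f = 3 : across_spec z (z.1, b)
| Cross k h c w a c' of k < 3 & incident z.1 = [set z.2; h; c] & uniq [:: z.2; h; c]
    & incident w = [set a; h; c'] & uniq [:: a; h; c'] & ends h = [set z.1; w] & w != z.1
    & mult a = 0 & sgn h = counit_sgn k & sgn c = unit_sgn k & sgn c' = unit_sgn k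
  : across_spec z (w, a).

Lemma acrossP z : dart z -> across_spec z (across z).
Proof.
case: z => v e /andP[/= ve /eqP me]; have eI : e \in incident v by rewrite inE.
case: (vertexP v) => [a b c def_v _ sa sb sc|k a h c k3 def_v uv ma sh sc|a b c def_v uv ma mb mc].
- have : mult e = 1; last by rewrite me.
  move: eI; rewrite def_v; move: e {ve me}; apply: in_set3P; [exact: (mult_unit _ sa)|exact: (mult_unit _ sb)|exact: (mult_unit _ sc)].
- have {eI} eea : e = a.
    move: eI me; rewrite def_v; move: e {ve}; apply: in_set3P => //.
      by rewrite (mult_counit k3 sh).
    by rewrite (mult_unit k3 sc).
  subst a; have [_ p2 _] := bivalent_picks k3 def_v ma sh sc.
  have : h \in incident v by rewrite def_v !inE eqxx orbT.
  rewrite inE => hv.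
  have [def_h neq opp2] := oppP hv; rewrite /across /= p2; set w := opp h v in def_h neq *.
  have hw : h \in incident w by rewrite inE def_h !inE eqxx orbT.
  have mh := mult_counit k3 sh.
  case: (vertexP w) => [a' b' c'' def_w _ sa sb sc'|k' a' h' c' k3' def_w uw ma' sh' sc'|a' b' c' def_w uw ma' mb mc].
  + have : mult h = 1; last by rewrite mh.
    move: hw; rewrite def_w; move: (h); apply: in_set3P; [exact: (mult_unit _ sa)|exact: (mult_unit _ sb)|exact: (mult_unit _ sc')].
  + have ehh : h = h'.
      move: hw mh; rewrite def_w; move: (h); apply: in_set3P => //; first by rewrite ma'.
      by rewrite (mult_unit k3' sc').
    (* The 1-factor missing [h] is read off [h] itself, so both ends send out edges of the same
       colour and a letter K needs a single label. *)
    subst h'; have ekk : k' = k by apply: counit_inj; rewrite // -sh -sh'.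
    subst k'; have [-> _ _] := bivalent_picks k3 def_w ma' sh sc'.
    exact: (@Cross (v, e) k h c w a' c').
  by move: hw mh; rewrite def_w !inE -orbA => /or3P[]/eqP->; rewrite ?ma' ?mb ?mc.
have [p2 _] := trivalent_picks def_v ma mb mc; rewrite /across /= p2.
have [d [def_d ud md]] : exists d, [/\ incident v = [set e; d; c], uniq [:: e; d; c] & mult d = 0].
  move: eI; rewrite {1}def_v !inE -orbA => /or3P[]/eqP ee; subst e; first by exists b.
    exists a; rewrite (setUC [set b]); split=> //; move: uv; rewrite /= !inE !negb_or eq_sym.
    by rewrite !andbT => /andP[/andP[-> ->] ->].
  by rewrite mc in me.
case: pickP => [d'|/(_ d)]; last first.
  rewrite /= md def_d !inE !eqxx orbT !andbT.
  by move: ud; rewrite /= !inE negb_or eq_sym => /andP[/andP[-> _]].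
case/andP=> d'v /eqP md'.
suff -> : d' = d by exact: (@Pass (v, e) d c).
move: d'v; rewrite def_d in_setD1 => /andP[d'e d'I]; move: d' d'I md' d'e.
by apply: in_set3P; rewrite ?eqxx ?mc.
Qed.

Lemma set2_other (T : finType) (u v w : T) : [set u; v] = [set v; w] -> u != v -> w = u.
Proof.
by move=> /setP/(_ u); rewrite !inE eqxx => /esym/orP[/eqP->|/eqP->]; rewrite ?eqxx.
Qed.

Lemma acrossK z : dart z -> [/\ dart (across z), across (across z) = z & across z != z].
Proof.
case: z => v e Dz; have /andP[/= ve /eqP me] := Dz.
case: (acrossP Dz) => [b f|k h c w a c'] /=.
  move=> def_v uv mb mf.
  have bI : b \in incident v by rewrite def_v !inE eqxx orbT.
  have Dz' : dart (v, b) by move: bI; rewrite inE /dart mb /= => ->.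
  have eb : e != b by move: uv; rewrite /= !inE negb_or => /andP[/andP[]].
  split=> //; last by apply: contraNneq eb => -[->].
  case: (acrossP Dz') => [b' f'|k h c w a c'] /=.
    move=> def_v' _ mb' mf'; congr (_, _); have : e \in incident v by rewrite inE.
    rewrite def_v' !inE (negPf eb) /= => /orP[]/eqP // ef.
    by rewrite -ef me in mf'.
  move=> k3 def_v' _ _ _ _ _ _ sh _ _; have mh := mult_counit k3 sh.
  have : h \in incident v by rewrite def_v' !inE eqxx orbT.
  by move: mh; rewrite def_v !inE -orbA => + /or3P[]/eqP eh; rewrite eh ?me ?mb ?mf.
move=> k3 def_v uv def_w uw def_h wv ma sh sc sc'.
have mh := mult_counit k3 sh; have mc' := mult_unit k3 sc'.
have aI : a \in incident w by rewrite def_w !inE eqxx.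
have Dz' : dart (w, a) by move: aI; rewrite inE /dart ma /= => ->.
have hI : h \in incident w by rewrite def_w !inE eqxx orbT.
split=> //; last by apply: contraNneq wv => -[->].
case: (acrossP Dz') => [b f|k2 h2 c2 w2 a2 c2'] /=.
  move=> def_w' _ mb mf.
  by move: hI mh; rewrite def_w' !inE -orbA => /or3P[]/eqP ->; rewrite ?ma ?mb ?mf.
move=> k23 def_w' _ def_w2 _ def_h2 _ ma2 sh2 _ sc2'; have mh2 := mult_counit k23 sh2.
have eh : h2 = h.
  have : h2 \in incident w by rewrite def_w' !inE eqxx orbT.
  by rewrite def_w !inE -orbA => /or3P[]/eqP // eh; move: mh2; rewrite eh ?ma ?mc'.
subst h2; have ew2 : w2 = v by rewrite def_h in def_h2; apply: set2_other def_h2 _; rewrite eq_sym.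
subst w2; congr (_, _); have : e \in incident v by rewrite inE.
rewrite def_w2 !inE -orbA => /or3P[]/eqP // ee; move: me; rewrite ee.
  by rewrite mh.
by rewrite (mult_unit k23 sc2').
Qed.

(** * Oriented circuits, their letters, and the pairing of letters by E_3 *)

Section Orientation.
Variable P : pred (vertex G * edge G).
Hypothesis P_alt : forall z, dart z -> P (across z) = ~~ P z /\ P (other_end z) = ~~ P z.

(* [P] selects the darts pointing forwards.  A letter is represented by the gap
   following it, so that [next_gap] is the successor of letters. *)
Definition gap := {e : edge G | mult e == 0}.
Implicit Types g : gap.

Lemma tail_ex g : exists v, (v \in ends (val g)) && P (v, val g).
Proof.
have [v vg] : exists v, v \in ends (val g).
  by apply/card_gt0P; rewrite card_ends.
have Dv : dart (v, val g) by rewrite /dart vg (valP g).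
have [def_g _ _] := oppP vg; have [_ Po] := P_alt Dv.
case Pv: (P (v, val g)); first by exists v; rewrite vg.
by exists (opp (val g) v); rewrite {1}def_g !inE eqxx orbT; move: Po; rewrite Pv.
Qed.

Definition tail g := xchoose (tail_ex g).
Definition head g := opp (val g) (tail g).

Lemma tailP g : [/\ dart (tail g, val g), P (tail g, val g),
  dart (head g, val g), P (head g, val g) = false & ends (val g) = [set head g; tail g]].
Proof.
have /andP[tg Pt] := xchooseP (tail_ex g); rewrite -/(tail g) in tg Pt.
have Dt : dart (tail g, val g) by rewrite /dart tg (valP g).
have [Dh _ _] := other_endP Dt; have [_ Ph] := P_alt Dt.
by split=> //; [rewrite -[LHS]/(P (other_end (tail g, val g))) Ph Pt | rewrite setUC; case: (oppP tg)].
Qed.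

Lemma tail_eq g v : v \in ends (val g) -> P (v, val g) -> v = tail g.
Proof.
have [_ _ _ Ph ->] := tailP g; rewrite !inE => /orP[]/eqP-> //.
by rewrite Ph.
Qed.

Lemma head_eq g v : v \in ends (val g) -> ~~ P (v, val g) -> v = head g.
Proof.
have [_ Pt _ _ ->] := tailP g; rewrite !inE => /orP[]/eqP-> //.
by rewrite Pt.
Qed.

(** The default [g] is never taken, because [across] maps darts to darts. *)
Definition next_gap g : gap := insubd g (across (head g, val g)).2.

Lemma next_gapE g : across (head g, val g) = (tail (next_gap g), val (next_gap g)).
Proof.
have [_ _ Dh Ph _] := tailP g; have [Dn _ _] := acrossK Dh.
have [Pn _] := P_alt Dh; move: Dn Pn; rewrite Ph /next_gap.
case: (across _) => w a /andP[/= wa ma] Pw; rewrite val_insubd ma; congr (_, _).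
by apply: tail_eq; rewrite val_insubd ma.
Qed.

Lemma next_gap_inj : injective next_gap.
Proof.
move=> g g' eq_n; have [_ _ Dh _ _] := tailP g; have [_ _ Dh' _ _] := tailP g'.
have := next_gapE g; rewrite eq_n -next_gapE => /(congr1 across).
have [_ -> _] := acrossK Dh; have [_ -> _] := acrossK Dh'.
by case=> _ /val_inj.
Qed.

Definition gap_kind g : option nat :=
  omap (fun h => index false (sgn h)) (pick_mult 2 (tail g)).

Variant next_spec g : Prop :=
| NextV f of incident (head g) = [set val g; val (next_gap g); f]
    & uniq [:: val g; val (next_gap g); f] & mult f = 3
    & tail (next_gap g) = head g & gap_kind (next_gap g) = None
| NextK k h c c' of k < 3
    & incident (head g) = [set val g; h; c] & uniq [:: val g; h; c]
    & incident (tail (next_gap g)) = [set val (next_gap g); h; c']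
    & uniq [:: val (next_gap g); h; c'] & ends h = [set head g; tail (next_gap g)]
    & sgn h = counit_sgn k & sgn c = unit_sgn k & sgn c' = unit_sgn k
    & gap_kind (next_gap g) = Some k.

Lemma nextP g : next_spec g.
Proof.
have [_ _ Dh _ _] := tailP g; have := acrossP Dh; rewrite next_gapE.
set z := (head g, val g); set z' := (_, _) => spec.
have eq_z' : z' = (tail (next_gap g), val (next_gap g)) by [].
case: spec eq_z' => [b f|k h c w a c'] /=.
  move=> def_v uv mb mf [eq_t eq_b]; subst b.
  apply: (NextV def_v uv mf) => //; rewrite /gap_kind -eq_t.
  by have [->] := trivalent_picks def_v (eqP (valP g)) mb mf.
move=> k3 def_v uv def_w uw def_h _ ma sh sc sc' [eq_w eq_a]; subst a w.
apply: (NextK k3 def_v uv def_w uw def_h sh sc sc').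
rewrite /gap_kind; have [_ -> _] := bivalent_picks k3 def_w ma sh sc'.
by rewrite /= sh; case: (k) k3 => [|[|[|]]].
Qed.

Lemma next_surj g : exists g', next_gap g' = g.
Proof. by exists (finv next_gap g); rewrite f_finv //; apply: next_gap_inj. Qed.

Lemma gap_kind_lt g k : gap_kind g = Some k -> k < 3.
Proof.
by have [g' <-] := next_surj g; case: (nextP g') => [f|k' h c c'] => *; congruence.
Qed.

(** This excludes the circuit with a single letter V, for which there is no plan. *)
Lemma next_gap_neq g : gap_kind g == None -> next_gap g != g.
Proof.
move=> kg; apply/eqP => eq_g; move: kg; rewrite -{1}eq_g.
case: (nextP g) => [f _|k h c c' _ _ _ _ _ _ _ _ _ -> //].
by rewrite eq_g /= inE eqxx.
Qed.

(** At a trivalent vertex [across] exchanges the two darts, so [P] selects only one of them; at a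
    bivalent vertex there is only one edge of E_0. *)
Lemma tail_inj : injective tail.
Proof.
move=> g g' eq_t; have [Dt Pt _ _ _] := tailP g; have [Dt' Pt' _ _ _] := tailP g'.
have /eqP mg := valP g; have /eqP mg' := valP g'.
apply: val_inj; have : val g' \in incident (tail g).
  by rewrite inE eq_t; case/andP: Dt'.
have [Pa _] := P_alt Dt; rewrite /= in mg mg' Pt'.
move: Pa; rewrite Pt; case: (acrossP Dt) => /= [b f -> _ mb mf Pb|].
  rewrite !inE -orbA => /or3P[]/eqP eg; [exact: esym | | by rewrite eg mf in mg'].
  by rewrite eq_t -eg Pt' in Pb.
move=> k h c w a c' k3 -> _ _ _ _ _ _ sh sc _ _.
rewrite !inE -orbA => /or3P[]/eqP eg; first exact: esym; rewrite eg in mg'.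
  by rewrite (mult_counit k3 sh) in mg'.
by rewrite (mult_unit k3 sc) in mg'.
Qed.

(** A letter K is its own twin, so that [twin] is an involution on all letters. *)
Definition twin g : gap :=
  if pick_mult 3 (tail g) is Some h then
    odflt g [pick g' : gap | tail g' == opp h (tail g)]
  else g.

(** The far end of [h] carries an edge of E_3 and is therefore trivalent; [across] exchanges its two
    darts, and the one selected by [P] makes it the tail of a gap. *)
Lemma twin_spec g h : pick_mult 3 (tail g) = Some h ->
  [/\ h \in incident (tail g), mult h = 3 & tail (twin g) = opp h (tail g)].
Proof.
move=> ph; have [hI mh] : h \in incident (tail g) /\ mult h = 3.
  by move: ph; rewrite /pick_mult; case: pickP => // h' /andP[h'I /eqP mh'] [<-].
split=> //; rewrite /twin ph; set w := opp h _.
suff [g' eq_g'] : exists g', tail g' = w.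
  by case: pickP => [g2 /eqP //|/(_ g')]; rewrite eq_g' eqxx.
have hw : h \in incident w.
  move: hI; rewrite !inE => /oppP[def_h _ _].
  by rewrite def_h !inE eqxx orbT.
case: (vertexP w) => [a b c def_w _ sa sb sc|k a b c k3 def_w _ ma sb sc|a b c def_w uw ma mb mc].
- move: hw; rewrite def_w !inE -orbA => /or3P[]/eqP eh; move: mh; rewrite eh.
  + by rewrite (mult_unit _ sa).
  + by rewrite (mult_unit _ sb).
  by rewrite (mult_unit _ sc).
- move: hw; rewrite def_w !inE -orbA => /or3P[]/eqP eh; move: mh; rewrite eh.
  + by rewrite ma.
  + by rewrite (mult_counit k3 sb).
  by rewrite (mult_unit k3 sc).
have aI : a \in incident w by rewrite def_w !inE eqxx.
have Da : dart (w, a) by move: aI; rewrite inE /dart ma /= => ->.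
have [Da' _ _] := acrossK Da; have [Pa _] := P_alt Da.
have tl e (me : mult e == 0) : w \in ends e -> P (w, e) -> exists g', tail g' = w.
  by move=> we Pe; exists (Sub e me); apply/esym/tail_eq.
case Pwa: (P (w, a)); first by apply: (tl a _ _ Pwa); rewrite ?ma //; case/andP: Da.
move: Da' Pa; rewrite Pwa; case: (acrossP Da) => /= [b' f' _ _ _ _ /andP[/= wb mb'] Pb|].
  exact: (tl b' mb' wb).
move=> k h2 c2 w2 a2 c2' k3 def_w2 _ _ _ _ _ _ sh2 _ _.
have : h2 \in incident w by rewrite def_w2 !inE eqxx orbT.
rewrite def_w !inE -orbA => /or3P[]/eqP eh; move: (mult_counit k3 sh2); rewrite eh.
- by rewrite ma.
- by rewrite mb.
by rewrite mc.
Qed.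

Lemma twin_inv : involutive twin.
Proof.
move=> g; case ph: (pick_mult 3 (tail g)) => [h|]; last by rewrite /twin ph ph.
have [hI mh eq_t] := twin_spec ph.
have hv : h \in incident (tail (twin g)).
  by move: hI; rewrite eq_t !inE => /oppP[def_h _ _]; rewrite def_h !inE eqxx orbT.
have ph' : pick_mult 3 (tail (twin g)) = Some h.
  move: (tail _) hv => w hv; move: hv.
  case: (vertexP w) => [a b c def_w _ sa sb sc|k a b c k3 def_w _ ma sb sc|a b c def_w uw ma mb mc].
  - rewrite {1}def_w !inE -orbA => /or3P[]/eqP eh; move: mh; rewrite eh.
    + by rewrite (mult_unit _ sa).
    + by rewrite (mult_unit _ sb).
    by rewrite (mult_unit _ sc).
  - rewrite {1}def_w !inE -orbA => /or3P[]/eqP eh; move: mh; rewrite eh.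
    + by rewrite ma.
    + by rewrite (mult_counit k3 sb).
    by rewrite (mult_unit k3 sc).
  have [_ ->] := trivalent_picks def_w ma mb mc.
  rewrite {1}def_w !inE -orbA => /or3P[]/eqP eh //; last by rewrite eh.
    by move: mh; rewrite eh ma.
  by move: mh; rewrite eh mb.
apply: tail_inj; have [_ _ ->] := twin_spec ph'; rewrite eq_t.
by move: hI; rewrite inE => /oppP[].
Qed.

Lemma set3_rev (T : finType) (t1 t2 t3 : T) : [set t1; t2; t3] = [set t3; t2; t1].
Proof. by rewrite setUC setUAC setUA setUC setUA. Qed.

(** * The edge colouring and the count of its bad edges *)

Section Colouring.
Variables (lam : gap -> bool) (x : gap -> nat) (c : gap -> nat * nat).
Hypotheses (x_lt : forall g, x g < 3) (lam_twin : forall g, lam (twin g) = lam g)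
  (x_twin : forall g, x (twin g) = x g)
  (c_fits : forall g, circuit_fits gap_kind next_gap lam x c g).

(** The gap picked for an edge outside E_0 and E_1 does not matter: an edge of E_2 touches the tail
    of one gap only ([core_phi_even]), and an edge of E_3 touches the tails of two twins, where
    [lam] agrees ([core_phi_leg]). *)
Definition core_phi e : nat :=
  if mult e == 1 then index true (sgn e)
  else if insub e is Some g then (c (g : gap)).1
  else if [pick g : gap | e \in incident (tail g)] is Some g then
    if mult e == 2 then (c g).2 else legcol (lam g)
  else 0.

Lemma core_phi_gap g : core_phi (val g) = (c g).1.
Proof. by rewrite /core_phi (eqP (valP g)) /= valK. Qed.

Lemma core_phi_unit e k : k < 3 -> sgn e = unit_sgn k -> core_phi e = k.
Proof.
move=> k3 se; rewrite /core_phi (mult_unit k3 se) eqxx se.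
by case: k k3 {se} => [|[|[|]]].
Qed.

Lemma core_phi_even g k h a b : k < 3 -> incident (head g) = [set val g; h; a] ->
  incident (tail (next_gap g)) = [set val (next_gap g); h; b] ->
  ends h = [set head g; tail (next_gap g)] ->
  sgn h = counit_sgn k -> sgn a = unit_sgn k -> core_phi h = (c (next_gap g)).2.
Proof.
move=> k3 def_u def_w def_h sh sa; have mh := mult_counit k3 sh.
rewrite /core_phi mh insubF ?mh //.
case: pickP => [g' hg'|/(_ (next_gap g))]; last by rewrite def_w !inE eqxx orbT.
suff -> : g' = next_gap g by [].
have := hg'; rewrite inE def_h !inE => /orP[]/eqP eq_t; last exact: tail_inj.
have [/andP[/= vg' _] Pt _ _ _] := tailP g'; have [_ _ _ Ph _] := tailP g.
have : val g' \in incident (head g) by rewrite -eq_t inE.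
have /eqP mg' := valP g'; rewrite def_u !inE -orbA => /or3P[]/eqP eg.
- by move: Pt; rewrite eq_t eg Ph.
- by rewrite eg mh in mg'.
by rewrite eg (mult_unit k3 sa) in mg'.
Qed.

Lemma core_phi_leg g h : incident (head g) = [set val g; val (next_gap g); h] ->
  mult h = 3 -> tail (next_gap g) = head g -> core_phi h = legcol (lam (next_gap g)).
Proof.
move=> def_v mh eq_t; rewrite /core_phi mh insubF ?mh //.
have hI : h \in incident (tail (next_gap g)) by rewrite eq_t def_v !inE eqxx orbT.
case: pickP => [g' hg'|/(_ (next_gap g))]; last by rewrite hI.
have ph : pick_mult 3 (tail (next_gap g)) = Some h.
  rewrite eq_t; have [_ ->//] := trivalent_picks def_v (eqP (valP g)) (eqP (valP (next_gap g))) mh.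
have [_ _ tw] := twin_spec ph; move: hI hg'; rewrite !inE => /oppP[def_h _ _].
rewrite def_h !inE => /orP[]/eqP; first by move/tail_inj->.
by rewrite -tw => /tail_inj->; rewrite lam_twin.
Qed.

Definition dat := datum_of gap_kind lam x.

Variant head_spec g : Prop :=
| HeadV h of incident (head g) = [set val g; h; val (next_gap g)]
    & tail (next_gap g) = head g & mult h = 3
    & dat (next_gap g) = inr (lam (next_gap g), x (next_gap g))
    & core_phi h = legcol (lam (next_gap g))
| HeadK k h a b of k < 3 & incident (head g) = [set val g; h; a]
    & incident (tail (next_gap g)) = [set val (next_gap g); h; b]
    & ends h = [set head g; tail (next_gap g)]
    & mult h = 2 & mult a = 1 & mult b = 1 & dat (next_gap g) = inl k
    & core_phi h = (c (next_gap g)).2 & core_phi a = k & core_phi b = k.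

Lemma headP g : head_spec g.
Proof.
case: (nextP g) => [h def_v uv mh eq_t kn|k h a b k3 def_u uu def_w uw def_h sh sa sb kn].
  apply: (@HeadV _ h) => //; first by rewrite def_v setUAC.
    by rewrite /dat /datum_of kn.
  exact: core_phi_leg.
apply: (@HeadK _ k h a b) => //.
- exact: mult_counit sh.
- exact: mult_unit sa.
- exact: mult_unit sb.
- by rewrite /dat /datum_of kn.
- exact: (core_phi_even k3 def_u def_w def_h sh sa).
- exact: core_phi_unit.
exact: core_phi_unit.
Qed.

Lemma head_pair g : exists a b, incident (head g) = [set val g; a; b] /\
  (core_phi a, core_phi b) = left_pair (dat (next_gap g), c (next_gap g)).
Proof.
case: (headP g) => [h def_v _ _ dn ph|k h a b _ def_v _ _ _ _ _ dn ph pa _].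
  by exists h, (val (next_gap g)); rewrite ph core_phi_gap dn.
by exists h, a; rewrite ph pa dn.
Qed.

Lemma tail_pair g : exists a b, incident (tail g) = [set val g; a; b] /\
  (core_phi a, core_phi b) = right_pair (c (finv next_gap g)).1 (dat g, c g).
Proof.
set p := finv next_gap g.
have np : next_gap p = g by apply: f_finv; apply: next_gap_inj.
case: (headP p) => [h|k h a b]; rewrite np.
  move=> def_v eq_t _ dn ph; exists h, (val p); rewrite core_phi_gap ph dn eq_t def_v.
  by split=> //; apply: set3_rev.
by move=> _ _ def_w _ _ _ _ dn ph _ pb; exists h, b; rewrite ph pb dn.
Qed.

Lemma core_vertex v e : v \in ends e -> mult e != 1 ->
  (exists g, v = head g) \/ (exists g, v = tail (next_gap g)).
Proof.
move=> ve me; have eI : e \in incident v by rewrite inE.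
have [a aI ma] : exists2 a, a \in incident v & mult a == 0.
  case: (vertexP v) => [a b d def_v _ sa sb sd|k a b d _ def_v _ ma _ _|a b d def_v _ ma _ _].
  - move: eI me; rewrite def_v !inE -orbA => /or3P[]/eqP->.
    + by rewrite (mult_unit _ sa).
    + by rewrite (mult_unit _ sb).
    by rewrite (mult_unit _ sd).
  - by exists a; rewrite ?ma // def_v !inE eqxx.
  by exists a; rewrite ?ma // def_v !inE eqxx.
rewrite inE in aI; pose g : gap := Sub a ma.
case: (boolP (P (v, a))) => Pva; last by left; exists g; apply: head_eq.
have [g' eq_g'] := next_surj g.
by right; exists g'; rewrite eq_g'; apply: tail_eq.
Qed.

Lemma vertex_colours v : exists a b d, [/\ incident v = [set a; b; d],
  uniq [:: core_phi a; core_phi b; core_phi d]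
  & [&& core_phi a < 5, core_phi b < 5 & core_phi d < 5]].
Proof.
have c_lt g : (c g).1 < 5.
  have [g' <-] := next_surj g; have := c_fits g'; rewrite /circuit_fits /fits.
  by case: datum_of => [k /andP[]|[l y] /andP[]].
have at_head g : exists a b d, [/\ incident (head g) = [set a; b; d],
    uniq [:: core_phi a; core_phi b; core_phi d]
    & [&& core_phi a < 5, core_phi b < 5 & core_phi d < 5]].
  have := c_fits g; rewrite /circuit_fits.
  case: (headP g) => [h def_v _ _ dn ph|k h a b k3 def_v _ _ _ _ _ dn ph pa _]; rewrite -/dat dn /=.
    case/and4P=> _ n1 n2 n3; exists (val g), (val (next_gap g)), h.
    rewrite def_v setUAC !core_phi_gap ph !c_lt; split=> //.
      by rewrite /= !inE negb_or n1 n2 n3.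
    by case: (lam _).
  case/and5P=> _ e5 n1 n2 /and3P[n3 n4 n5]; exists (val g), h, a.
  rewrite def_v core_phi_gap ph pa c_lt e5 (leq_trans k3) //; split=> //.
  by rewrite /= !inE negb_or n1 n4 eq_sym n3.
have at_tail g : exists a b d, [/\ incident (tail (next_gap g)) = [set a; b; d],
    uniq [:: core_phi a; core_phi b; core_phi d]
    & [&& core_phi a < 5, core_phi b < 5 & core_phi d < 5]].
  have := c_fits g; rewrite /circuit_fits.
  case: (headP g) => [h _ -> _ _ _|k' h a' b' k3 _ def_w _ _ _ _ dn ph _ pb].
    by move=> _; apply: at_head.
  rewrite -/dat dn /=; case/and5P=> _ e5 n1 n2 /and3P[n3 n4 n5].
  exists (val (next_gap g)), h, b'.
  rewrite def_w core_phi_gap ph pb c_lt e5 (leq_trans k3) //; split=> //.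
  by rewrite /= !inE negb_or n2 n5 eq_sym n3.
have core a : a \in incident v -> mult a = 0 -> exists a b d,
    [/\ incident v = [set a; b; d], uniq [:: core_phi a; core_phi b; core_phi d]
    & [&& core_phi a < 5, core_phi b < 5 & core_phi d < 5]].
  by rewrite inE => aI ma; case: (core_vertex aI) => [|[g ->]|[g ->]]; rewrite ?ma.
case: (vertexP v) => [a b d def_v _ sa sb sd|k a b d _ def_v _ ma _ _|a b d def_v _ ma _ _].
- exists a, b, d; rewrite (core_phi_unit _ sa) // (core_phi_unit _ sb) //.
  by rewrite (core_phi_unit _ sd).
- by apply: (core a); rewrite // def_v !inE eqxx.
by apply: (core a); rewrite // def_v !inE eqxx.
Qed.

Lemma core_phi_lt e : core_phi e < 5.
Proof.
have [v] : exists v, v \in ends e by apply/card_gt0P; rewrite card_ends.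
have [a [b [d [def_v _ /and3P[a5 b5 d5]]]]] := vertex_colours v.
have : e \in incident v -> core_phi e < 5.
  by rewrite def_v !inE -orbA => /or3P[]/eqP->.
by rewrite inE.
Qed.

Lemma core_phi_inj v : {in incident v &, injective core_phi}.
Proof.
have [a [b [d [-> u _]]]] := vertex_colours v.
move: u; rewrite /= !inE negb_or andbT => /andP[/andP[/eqP nab /eqP nad] /eqP nbd].
move=> e h; rewrite !inE -!orbA => /or3P[]/eqP-> /or3P[]/eqP-> // eq_phi;
  by [case: nab | case: nad | case: nbd].
Qed.

Definition colour_of e : 'I_5 := inord (core_phi e).

Lemma colour_proper : proper_coloring colour_of.
Proof. exact: (proper_inord core_phi_lt core_phi_inj). Qed.

Lemma gain_normal g : circuit_gain gap_kind next_gap lam x c g -> normal colour_of (val g).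
Proof.
rewrite /circuit_gain /gap_normal -/dat.
have [a [b [def_u]]] := head_pair g; have [a' [b' [def_w]]] := tail_pair g.
case: (right_pair _ _) => r1 r2 [<- <-]; case: (left_pair _) => l1 l2 [<- <-].
rewrite -core_phi_gap /=; have [_ _ _ _] := tailP g; rewrite setUC => def_g.
exact: (normal_inord core_phi_lt def_g def_w def_u).
Qed.

Definition pick_edge n v e := odflt e (pick_mult n v).

(* The bad edges outside E_0 charged to the letter represented by [next_gap g];
   their number is the cost of this letter. *)
Definition bad_edges g : seq (edge G) :=
  let n := next_gap g in
  if gap_kind n is Some k then
    nseq (~~ normal_cols [:: (c n).2; (c g).1; k; (c n).1; k]) (pick_edge 2 (head g) (val g))
    ++ nseq (~~ same_side (c g).1 (c n).2) (pick_edge 1 (head g) (val g))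
    ++ nseq (~~ same_side (c n).1 (c n).2) (pick_edge 1 (tail n) (val g))
  else nseq (~~ matched (x n) (c g).1 (c n).1) (pick_edge 3 (head g) (val g)).

Lemma size_bad_edges g :
  size (bad_edges g) = circuit_cost gap_kind next_gap lam x c g.
Proof.
rewrite /bad_edges /circuit_cost /datum_of /letter_cost.
by case: gap_kind => [k|]; rewrite ?size_cat !size_nseq ?addnA.
Qed.

Lemma kindK g k : dat (next_gap g) = inl k -> gap_kind (next_gap g) = Some k.
Proof. by rewrite /dat /datum_of; case: gap_kind => // k' [->]. Qed.

Lemma kindV g l : dat (next_gap g) = inr l -> gap_kind (next_gap g) = None.
Proof. by rewrite /dat /datum_of; case: gap_kind. Qed.

Lemma pick_set3 n v e a b e0 : incident v = [set e; a; b] -> mult e = n ->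
  mult a != n -> mult b != n -> pick_edge n v e0 = e.
Proof.
move=> def_v me ma mb; rewrite /pick_edge (@pick_multE n v e) //.
  by rewrite def_v !inE eqxx.
move=> e'; rewrite def_v !inE -orbA => /or3P[]/eqP-> // mn.
  by rewrite mn eqxx in ma.
by rewrite mn eqxx in mb.
Qed.

Lemma set3_swap (T : finType) (t1 t2 t3 : T) : [set t1; t2; t3] = [set t2; t1; t3].
Proof. by rewrite (setUC [set t1]). Qed.

Lemma set3_mid (T : finType) (t1 t2 t3 : T) : [set t1; t2; t3] = [set t3; t1; t2].
Proof. by rewrite setUC setUA. Qed.

Definition charged e := exists g, e \in bad_edges g.

Lemma even_charged e : mult e = 2 -> normal colour_of e \/ charged e.
Proof.
move=> me; have [v ve] : exists v, v \in ends e by apply/card_gt0P; rewrite card_ends.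
have eI : e \in incident v by rewrite inE.
have [g e_in] : exists g, e \in incident (head g) \/ e \in incident (tail (next_gap g)).
  have [|[g eq_v]|[g eq_v]] := core_vertex ve; rewrite ?me //.
    by exists g; left; rewrite -eq_v.
  by exists g; right; rewrite -eq_v.
case: (headP g) e_in => [h def_v eq_t mh _ _|k h a b k3 def_u def_w def_h mh ma mb dn ph pa pb] e_in.
  have {e_in} : e \in incident (head g) by case: e_in; rewrite ?eq_t.
  have /eqP mg := valP g; have /eqP mn := valP (next_gap g).
  by rewrite def_v !inE -orbA => /or3P[]/eqP ee; move: me; rewrite ee ?mg ?mn ?mh.
have /eqP mg := valP g; have /eqP mn := valP (next_gap g).
have ee : e = h.
  by case: e_in; rewrite ?def_u ?def_w !inE -orbA => /or3P[]/eqP ee //;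
     move: me; rewrite ee ?mg ?mn ?ma ?mb.
subst e; case nm: (normal_cols [:: (c (next_gap g)).2; (c g).1; k; (c (next_gap g)).1; k]).
  left; apply: (normal_inord core_phi_lt def_h (a := val g) (b := a)
    (a' := val (next_gap g)) (b' := b)).
  - by rewrite def_u set3_swap.
  - by rewrite def_w set3_swap.
  by rewrite ph pa pb !core_phi_gap.
right; exists g; rewrite /bad_edges (kindK dn) mem_cat nm.
rewrite (@pick_set3 2 _ h (val g) a) ?mh ?mg ?ma ?inE ?eqxx //.
by rewrite def_u set3_swap.
Qed.

Lemma leg_head e v : mult e = 3 -> v \in ends e -> exists g,
  [/\ head g = v, tail (next_gap g) = v, incident v = [set e; val g; val (next_gap g)],
      gap_kind (next_gap g) = None & core_phi e = legcol (lam (next_gap g))].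
Proof.
move=> me ve; have eI : e \in incident v by rewrite inE.
have [g eq_v] : exists g, v = head g \/ v = tail (next_gap g).
  have [|[g eq_v]|[g eq_v]] := core_vertex ve; rewrite ?me //; exists g; [by left|by right].
have /eqP mg := valP g; have /eqP mn := valP (next_gap g).
case: (headP g) eq_v => [h def_v eq_t mh dn ph|k h a b k3 def_u def_w def_h mh ma mb _ _ _ _] eq_v.
  have {}eq_v : head g = v by case: eq_v; rewrite ?eq_t.
  exists g; rewrite eq_t eq_v; move: eI; rewrite -eq_v def_v !inE -orbA.
  case/or3P=> /eqP ee; [by move: me; rewrite ee mg| subst h |by move: me; rewrite ee mn].
  by split=> //; [rewrite set3_swap | exact: kindV dn].
by case: eq_v => eq_v; move: eI; rewrite eq_v ?def_u ?def_w !inE -orbA => /or3P[]/eqP ee;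
   move: me; rewrite ee ?mg ?mn ?mh ?ma ?mb.
Qed.

(** The letters at the two ends are twins and share leg colour and type: either both are matched and
    the edge is normal, or an unmatched end is charged. *)
Lemma leg_charged e : mult e = 3 -> normal colour_of e \/ charged e.
Proof.
move=> me; have [v ve] : exists v, v \in ends e by apply/card_gt0P; rewrite card_ends.
have [def_e wv _] := oppP ve; set w := opp e v in def_e wv.
have we : w \in ends e by rewrite def_e !inE eqxx orbT.
have [g [hg tg def_v kg pe]] := leg_head me ve.
have [g' [hg' tg' def_w kg' pe']] := leg_head me we.
have twg : twin (next_gap g) = next_gap g'.
  have ph : pick_mult 3 (tail (next_gap g)) = Some e.
    rewrite tg; have [_ ->//] : pick_mult 2 v = None /\ pick_mult 3 v = Some e.
    apply: (@trivalent_picks v (val g) (val (next_gap g)) e) => //.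
    - by rewrite def_v set3_mid set3_mid.
    - exact: (eqP (valP g)).
    exact: (eqP (valP (next_gap g))).
  by apply: tail_inj; have [_ _ ->] := twin_spec ph; rewrite tg tg'.
have bad g0 v0 : head g0 = v0 -> incident v0 = [set e; val g0; val (next_gap g0)] ->
    gap_kind (next_gap g0) = None ->
    matched (x (next_gap g0)) (c g0).1 (c (next_gap g0)).1 = false -> charged e.
  move=> hg0 def_v0 kg0 nm; exists g0; rewrite /bad_edges kg0 nm hg0.
  have /eqP mg := valP g0; have /eqP mn := valP (next_gap g0).
  by rewrite (pick_set3 _ def_v0) ?mg ?mn ?inE.
case m: (matched (x (next_gap g)) (c g).1 (c (next_gap g)).1); last first.
  by right; apply: bad def_v kg m.
case m': (matched (x (next_gap g')) (c g').1 (c (next_gap g')).1); last first.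
  by right; apply: bad def_w kg' m'.
left; apply: (normal_inord core_phi_lt def_e def_v def_w).
have un g0 : gap_kind (next_gap g0) = None ->
    uniq [:: (c g0).1; (c (next_gap g0)).1; legcol (lam (next_gap g0))].
  move=> kg0; have := c_fits g0; rewrite /circuit_fits /datum_of kg0.
  by case/and4P=> _ n1 n2 n3; rewrite /= !inE negb_or n1 n2 n3.
rewrite pe !core_phi_gap.
apply: (@normal_of_matched _ (x (next_gap g))) => //; rewrite -?core_phi_gap ?core_phi_lt //.
- by rewrite !core_phi_gap un.
- by rewrite -pe pe' !core_phi_gap un.
by rewrite !core_phi_gap -x_twin twg.
Qed.

Lemma good_endE v e a b : incident v = [set e; a; b] -> uniq [:: e; a; b] ->
  same_side (core_phi a) (core_phi b) -> good_end (core_phi e) (core_phi a) (core_phi b).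
Proof.
move=> def_v; rewrite /good_end !core_phi_lt /= !inE !negb_or !andbT => /andP[/andP[ea eb] ab] ->.
have [eI aI bI] : [/\ e \in incident v, a \in incident v & b \in incident v].
  by rewrite def_v !inE !eqxx !orbT.
by rewrite andbT !(inj_in_eq (core_phi_inj (v := v))) ?ea ?eb.
Qed.

(** Off the circuits, the other two colours at [v] are below 3 and the end is good. On a circuit [v]
    is bivalent, and a failure of [same_side] is charged to the letter K there. *)
Lemma unit_end e v : mult e = 1 -> v \in ends e -> charged e \/
  exists a b, incident v = [set e; a; b] /\ good_end (core_phi e) (core_phi a) (core_phi b).
Proof.
move=> me ve; have eI : e \in incident v by rewrite inE.
have small k e' : k < 3 -> sgn e' = unit_sgn k -> (2 < core_phi e') = false.
  by move=> k3 se; rewrite (core_phi_unit k3 se) ltnNge -ltnS k3.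
have core a : a \in incident v -> mult a = 0 -> charged e \/
  exists a b, incident v = [set e; a; b] /\ good_end (core_phi e) (core_phi a) (core_phi b).
  rewrite inE => va ma.
  have [g eq_v] : exists g, v = head g \/ v = tail (next_gap g).
    have [|[g eq_v]|[g eq_v]] := core_vertex va; rewrite ?ma //; exists g; [by left|by right].
  have /eqP mg := valP g; have /eqP mn := valP (next_gap g).
  case: (headP g) eq_v => [h def_v eq_t mh dn ph|k h a' b k3 def_u def_w def_h mh ma' mb dn ph pa pb] eq_v.
    have {}eq_v : v = head g by case: eq_v; rewrite ?eq_t.
    by move: eI; rewrite eq_v def_v !inE -orbA => /or3P[]/eqP ee; move: me; rewrite ee ?mg ?mn ?mh.
  case: eq_v => eq_v.
    have ee : e = a'.
      by move: eI; rewrite eq_v def_u !inE -orbA => /or3P[]/eqP ee //; move: me; rewrite ee ?mg ?mh.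
    subst a'; have def_v : incident v = [set e; val g; h] by rewrite eq_v def_u set3_mid.
    case ss: (same_side (c g).1 (c (next_gap g)).2).
      right; exists (val g), h; split=> //; apply: (good_endE def_v); last by rewrite core_phi_gap ph.
      rewrite /= !inE !negb_or andbT -andbA; apply/and3P; split; apply/eqP => eq_e.
      - by move: me; rewrite eq_e mg.
      - by move: me; rewrite eq_e mh.
      by move: mh; rewrite -eq_e mg.
    left; exists g; rewrite /bad_edges (kindK dn) !mem_cat ss -eq_v.
    by rewrite (pick_set3 _ def_v me) ?mg ?mh // inE eqxx orbT.
  have ee : e = b.
    by move: eI; rewrite eq_v def_w !inE -orbA => /or3P[]/eqP ee //; move: me; rewrite ee ?mn ?mh.
  subst b; have def_v : incident v = [set e; val (next_gap g); h] by rewrite eq_v def_w set3_mid.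
  case ss: (same_side (c (next_gap g)).1 (c (next_gap g)).2).
    right; exists (val (next_gap g)), h; split=> //; apply: (good_endE def_v); last by rewrite core_phi_gap ph.
    rewrite /= !inE !negb_or andbT -andbA; apply/and3P; split; apply/eqP => eq_e.
    - by move: me; rewrite eq_e mn.
    - by move: me; rewrite eq_e mh.
    by move: mh; rewrite -eq_e mn.
  left; exists g; rewrite /bad_edges (kindK dn) !mem_cat ss -eq_v.
  by rewrite (pick_set3 _ def_v me) ?mn ?mh // inE eqxx !orbT.
case: (vertexP v) => [a b d def_v uv sa sb sd|k a b d k3 def_v _ ma sb sd|a b d def_v _ ma mb md].
- right; move: uv; rewrite /= !inE negb_or andbT => /andP[/andP[ab ad] bd].
  move: eI; rewrite def_v !inE -orbA => /or3P[]/eqP->.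
  + exists b, d; split=> //; apply: (good_endE def_v).
      by rewrite /= !inE negb_or ab ad bd.
    by rewrite /same_side (small 1) // (small 2).
  + have def_v' : incident v = [set b; a; d] by rewrite def_v set3_swap.
    exists a, d; rewrite -def_v -def_v'; split=> //; apply: (good_endE def_v').
      by rewrite /= !inE negb_or eq_sym ab bd ad.
    by rewrite /same_side (small 0) // (small 2).
  have def_v' : incident v = [set d; a; b] by rewrite def_v set3_mid.
  exists a, b; rewrite -def_v -def_v'; split=> //; apply: (good_endE def_v').
    by rewrite /= !inE negb_or ![d == _]eq_sym ad bd ab.
  by rewrite /same_side (small 0) // (small 1).
- by apply: (core a); rewrite // def_v !inE eqxx.
by apply: (core a); rewrite // def_v !inE eqxx.
Qed.

Lemma unit_charged e : mult e = 1 -> normal colour_of e \/ charged e.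
Proof.
move=> me; have [v ve] : exists v, v \in ends e by apply/card_gt0P; rewrite card_ends.
have [def_e _ _] := oppP ve; set w := opp e v in def_e.
have we : w \in ends e by rewrite def_e !inE eqxx orbT.
have [|[a [b [def_v gv]]]] := unit_end me ve; first by right.
have [|[a' [b' [def_w gw]]]] := unit_end me we; first by right.
left; apply: (normal_inord core_phi_lt def_e def_v def_w).
apply: normal_of_good_ends gv gw; rewrite /core_phi me eqxx.
have sz : size (sgn e) = 3 by rewrite size_map size_tuple.
rewrite -[X in _ < X]sz index_mem.
by have /hasP[[]] : has id (sgn e) by rewrite has_count -mult_sgn me.
Qed.

Lemma mult_le3 e : mult e <= 3.
Proof. by apply: leq_trans (count_size _ _) _; rewrite size_tuple. Qed.

Lemma normal_or_charged e : mult e != 0 -> normal colour_of e \/ charged e.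
Proof.
case me: (mult e) (mult_le3 e) => [|[|[|[|]]]] // _ _.
- exact: unit_charged.
- exact: even_charged.
exact: leg_charged.
Qed.

Lemma normal_count :
  \sum_(g : gap) circuit_cost gap_kind next_gap lam x c g
    <= \sum_(g : gap) circuit_gain gap_kind next_gap lam x c g ->
  #|edge G| <= #|[set e | normal colour_of e]| + #|[set e | mult e == 0]|.
Proof.
set N := [set e | _]; set E0 := [set e | _] => le_cost.
(* After splitting by [N] and [E0], the edges in neither are to be bounded by those in both. The
   former all appear in some [bad_edges g], and the sizes of these lists add up to the total
   cost. *)
rewrite -cardsT -(cardsID N) setTI leq_add2l setTD -(cardsID E0 (~: N)).
rewrite -[leqRHS](cardsID N) addnC setIC -setDE leq_add //.
apply: (@leq_trans (\sum_(g : gap) circuit_gain gap_kind next_gap lam x c g)).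
  apply: leq_trans le_cost.
  rewrite (eq_bigr (fun g => size (bad_edges g))) => [|g _]; last by rewrite size_bad_edges.
  rewrite -[leqRHS](_ : size (flatten [seq bad_edges g | g <- index_enum gap]) = _); last first.
    by rewrite size_flatten /shape -map_comp sumnE big_map.
  apply: leq_trans (card_size _); apply/subset_leq_card/subsetP => e.
  rewrite !inE => /andP[me nn]; case: (normal_or_charged me) => [|[g eg]]; first by move=> ne; rewrite ne in nn.
  by apply/flattenP; exists (bad_edges g); rewrite ?map_f ?mem_index_enum.
rewrite -big_mkcond sum1_card -(card_image (@val_inj _ _ _)).
apply/subset_leq_card/subsetP => _ /imageP[g gg ->].
by rewrite !inE (valP g) gain_normal.
Qed.

End Colouring.
End Orientation.

Lemma three_factor_colouring : exists phi : edge G -> 'I_5,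
  proper_coloring phi /\ #|edge G| <= #|[set e | normal phi e]| + #|covered S 0|.
Proof.
have [P P_alt] := alternating_on acrossK other_endP.
have [lam [x [c [lamf x_lt xf c_fits le_c]]]] := core_colouring
  (@gap_kind_lt P P_alt) (twin_inv P_alt) (@next_gap_inj P P_alt) (@next_gap_neq P P_alt).
exists (colour_of P_alt lam c); split; first exact: colour_proper c_fits.
exact: normal_count le_c.
Qed.

End ThreeFactors.

(* Only needed when there is no 1-factor at all, where mu3 is the number of edges;
   this case is vacuous by Petersen's theorem. *)
Lemma five_colouring (G : multigraph) : cubic G ->
  exists phi : edge G -> 'I_5, proper_coloring phi.
Proof.
move=> cubG.
have [phi phiP] : exists phi : edge G -> 'I_5,
    {in enum (edge G) &, forall e h, adjacent e h -> phi e != phi h}; last first.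
  by exists phi => e h; apply: phiP; rewrite mem_enum.
elim: (enum (edge G)) => [|e s [phi phiP]]; first by exists (fun=> ord0).
have [col colP] : exists col, col \notin [set phi h | h in [set h | adjacent e h]].
  apply/existsP; rewrite -negb_forall; apply/negP => /forallP all_col.
  have : #|'I_5| <= #|[set h | adjacent e h]|.
    apply: leq_trans (leq_imset_card phi _); apply/subset_leq_card/subsetP => i _.
    exact: all_col.
  rewrite card_ord ltnNge; apply/negP; rewrite negbK.
  have /eqP/cards2P[u [w [_ def_e]]] := card_ends e.
  have inc v : v \in ends e -> #|incident v :\ e| = 2.
    move=> ve; have /forallP/(_ v)/eqP := cubG.
    by rewrite (cardsD1 e) inE ve add1n => -[].
  rewrite -[4]/(2 + 2) -{1}(inc u) ?def_e ?set21 // -(inc w) ?def_e ?set22 //.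
  apply: leq_trans (leq_card_setU _ _); apply/subset_leq_card/subsetP => h.
  rewrite !inE /adjacent => /andP[neq /set0Pn[v]]; rewrite def_e !inE.
  by rewrite (eq_sym h) neq => /andP[/orP[]/eqP-> ->]; rewrite ?orbT.
have adjC f h : adjacent f h = adjacent h f by rewrite /adjacent eq_sym setIC.
have free h : adjacent e h -> phi h != col.
  by move=> eh; apply: contraNneq colP => <-; apply: imset_f; rewrite inE.
exists (fun h => if h == e then col else phi h) => f h.
rewrite !inE; case: (eqVneq f e) => [->|_] /=; case: (eqVneq h e) => [->|_] //= fs hs.
- by rewrite /adjacent eqxx.
- by move/free; rewrite eq_sym.
- by rewrite adjC; apply: free.
exact: phiP.
Qed.

Theorem theorem5 (G : multigraph) (hcubic : cubic G) (hbridgeless : bridgeless G) :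
  exists phi : edge G -> 'I_5,
    proper_coloring phi /\
    #|edge G| - mu3 G <= #|[set e : edge G | normal phi e]|.
Proof.
case: (boolP [exists M : {set edge G}, one_factor M]) => [/existsP ex_M|no_M].
  have /existsP[C /existsP[S /and3P[factS /eqP<- _]]] := has_core_mu3 ex_M.
  have [phi [phi_proper le_phi]] := three_factor_colouring hcubic factS.
  by exists phi; split; rewrite // leq_subLR addnC.
have [phi phi_proper] := five_colouring hcubic; exists phi; split=> //.
have -> : mu3 G = #|edge G|; last by rewrite subnn.
rewrite /mu3 big_pred0 // => k; apply/negbTE; apply: contra no_M.
case/existsP=> C /existsP[S /and3P[/allP factS _ _]].
by apply/existsP; exists (thead S); apply: factS; apply: mem_tnth.
Qed.
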